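(* Let $\mathcal{H}$ be a chordal clutter, let $x\in V(\mathcal{H})$ be a simplicial vertex of $\mathcal{H}$, and let $e=\{x,x_1,\ldots,x_d\}$ be an edge of $\mathcal{H}$ containing $x$ (with $x,x_1,\dots,x_d$ distinct). Let $R=\mathbb{K}[V(\mathcal{H})]$. Then (i) $\mathrm{reg}(R/I(\mathcal{H}))=\max\{\mathrm{reg}(R/((x_1\cdots x_d)+I(\mathcal{H}))),\ \mathrm{reg}(R/I(\mathcal{H}/\{x_1,\ldots,x_d\}))+d\}$, and (ii) $\mathrm{reg}(R/I(\mathcal{H}))\leq\max\left\{\sum_{i=1}^d\mathrm{reg}(R/I(\mathcal{H}\setminus x_i))+(d-1),\ \mathrm{reg}(R/I(\mathcal{H}/\{x_1,\ldots,x_d\}))+d\right\}.$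
   Context: $\mathbb{K}$ is a field. A clutter $\mathcal{H}$ on a finite vertex set $V(\mathcal{H})$ is a set $E(\mathcal{H})$ of subsets of $V(\mathcal{H})$ (edges) such that no edge is contained in a different edge, and $|e|\ge 2$ for every edge $e$. Minors of $\mathcal{H}$ (defined next) are allowed to have edges of cardinality less than $2$. For a vertex $v$, the deletion $\mathcal{H}\setminus v$ is the clutter on $V(\mathcal{H})\setminus\{v\}$ with edge set $\{e\in E(\mathcal{H}): v\notin e\}$; the contraction $\mathcal{H}/v$ is the clutter on $V(\mathcal{H})\setminus\{v\}$ whose edges are the inclusion-minimal sets among $\{e\setminus\{v\}: e\in E(\mathcal{H})\}$. $\mathcal{H}/\{x_1,\dots,x_d\}$ denotes the result of successively contracting $x_1,\dots,x_d$; equivalently its edges are the inclusion-minimal sets among $\{e'\setminus\{x_1,\dots,x_d\}: e'\in E(\mathcal{H})\}$. A minor of $\mathcal{H}$ is a clutter obtained from $\mathcal{H}$ by repeated deletions and/or contractions (including $\mathcal{H}$ itself). A vertex $v$ of a clutter is simplicial if for every two (distinct) edges $e_1,e_2$ containing $v$ there is an edge $e_3$ with $e_3\subseteq(e_1\cup e_2)\setminus\{v\}$. A clutter $\mathcal{H}$ is chordal if every minor of $\mathcal{H}$ (with nonempty vertex set) has a simplicial vertex. The edge ideal of a clutter $\mathcal{K}$ is $I(\mathcal{K})=(x^{e}: e\in E(\mathcal{K}))$, where $x^e=\prod_{y\in e}y$; for the minors $\mathcal{K}$ of $\mathcal{H}$ in the claim, $I(\mathcal{K})$ is regarded as the ideal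 of $R$ generated by these monomials. $\mathrm{reg}$ denotes Castelnuovo–Mumford regularity of graded $R$-modules, $\mathrm{reg}(M)=\max\{j-i:\dim_{\mathbb{K}}\mathrm{Tor}^R_i(M,\mathbb{K})_j\neq 0\}$. *)

(* Defs.v *)
From HB Require Import structures.
From Stdlib Require Import ClassicalEpsilon.
From mathcomp Require Import all_boot all_order all_algebra.
From mathcomp Require Import mpoly.
Set Implicit Arguments.
Unset Strict Implicit.
Unset Printing Implicit Defensive.
Import Order.TTheory GRing.Theory Num.Theory.
Local Open Scope ring_scope.

(* The ambient finite type [T] is fixed, and the vertex set is a separate     *)
(* field because minors live on smaller vertex sets; minors may also have     *)
(* edges with fewer than two elements, excluded only by [is_clutter].         *)

Record set_system (T : finType) :=
  SetSystem { vertices : {set T}; edges : {set {set T}} }.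

Definition antichain (T : finType) (E : {set {set T}}) : Prop :=
  forall e f : {set T}, e \in E -> f \in E -> e \subset f -> e = f.

Definition is_clutter (T : finType) (H : set_system T) : Prop :=
  [/\ forall e, e \in edges H -> e \subset vertices H,
      antichain (edges H) &
      forall e, e \in edges H -> (2 <= #|e|)%N].

Definition deletion (T : finType) (H : set_system T) (v : T) : set_system T :=
  SetSystem (vertices H :\ v) [set e in edges H | v \notin e].

Definition contraction (T : finType) (H : set_system T) (v : T) :
    set_system T :=
  let F := [set e :\ v | e in edges H] in
  SetSystem (vertices H :\ v) [set f | minset (fun g => g \in F) f].

Definition contraction_seq (T : finType) (H : set_system T) (vs : seq T) :
    set_system T :=
  foldl (@contraction T) H vs.

Inductive minor (T : finType) (H : set_system T) : set_system T -> Prop :=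
| minor_refl : minor H H
| minor_deletion G v :
    minor H G -> v \in vertices G -> minor H (deletion G v)
| minor_contraction G v :
    minor H G -> v \in vertices G -> minor H (contraction G v).

Definition simplicial (T : finType) (H : set_system T) (v : T) : Prop :=
  v \in vertices H /\
  forall e1 e2, e1 \in edges H -> e2 \in edges H -> e1 <> e2 ->
    v \in e1 -> v \in e2 ->
    exists2 e3, e3 \in edges H & e3 \subset (e1 :|: e2) :\ v.

Definition chordal (T : finType) (H : set_system T) : Prop :=
  is_clutter H /\
  forall G, minor H G -> vertices G != set0 -> exists v, simplicial G v.

Definition ideal_gen (R : comNzRingType) (gs : seq R) : R -> Prop :=
  fun f => exists c : 'I_(size gs) -> R, f = \sum_i c i * gs`_i.

Definition ideal_add (R : comNzRingType) (I J : R -> Prop) : R -> Prop :=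
  fun f => exists g h : R, [/\ I g, J h & f = g + h].

(* [{mpoly K[#|T|]}] is K[T]: the variable of [y : T] is indexed by the rank  *)
(* of [y] in the enumeration of [T].                                          *)
Definition vvar (K : fieldType) (T : finType) (y : T) : {mpoly K[#|T|]} :=
  'X_(enum_rank y).

Definition edge_monomial (K : fieldType) (T : finType) (e : {set T}) :
    {mpoly K[#|T|]} :=
  \prod_(y in e) vvar K y.

Definition edge_ideal (K : fieldType) (T : finType) (H : set_system T) :
    {mpoly K[#|T|]} -> Prop :=
  ideal_gen [seq edge_monomial K e | e <- enum (edges H)].
Arguments edge_ideal K {T} H.

(* The degree-[j] component of the shifted free module R(-a). *)
Definition shifted_homog (K : fieldType) (n : nat) (a j : nat)
    (p : {mpoly K[n]}) : bool :=
  if (a <= j)%N then p \is (j - a).-homog else p == 0.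

Definition matrix_map (R : comNzRingType) (B B' : finType)
    (A : B -> B' -> R) (c : B -> R) : B' -> R :=
  fun b' => \sum_b c b * A b b'.

Definition augment (K : fieldType) (n : nat) (B : finType)
    (a : B -> K) (c : B -> {mpoly K[n]}) : K :=
  \sum_b (c b)@_0%MM * a b.

(* A graded resolution  ... -> Q_1 -> Q_0 -> K -> 0  of the residue field     *)
(* K = R/(x_1, ..., x_n) by graded free R-modules of finite rank.  Q_i is the *)
(* direct sum of the R(-shift b) over [b : basis i]; its elements are the     *)
(* functions [basis i -> R].                                                  *)
Record residue_resolution (K : fieldType) (n : nat) := ResidueResolution {
  basis : nat -> finType;
  shift : forall i, basis i -> nat;
  diff : forall i, basis i.+1 -> basis i -> {mpoly K[n]};
  aug : basis 0 -> K;
  diff_homog : forall i (b : basis i.+1) (b' : basis i),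
    shifted_homog (shift b') (shift b) (diff b b');
  aug_homog : forall b : basis 0, aug b != 0 -> shift b = 0%N;
  diff_exact : forall i (c : basis i.+1 -> {mpoly K[n]}),
    (matrix_map (@diff i) c =1 fun=> 0) <->
    (exists c', c =1 matrix_map (@diff i.+1) c');
  aug_exact : forall c : basis 0 -> {mpoly K[n]},
    augment aug c = 0 <-> (exists c', c =1 matrix_map (@diff 0) c');
  aug_surj : forall a : K, exists c : basis 0 -> {mpoly K[n]},
    augment aug c = a }.

(* For an ideal I of R, the tensor product of R/I with Q_i is Q_i / I Q_i,    *)
(* and Tor_i(R/I, K) is the homology of R/I tensored with Q.  A chain is      *)
(* represented by an element of Q_i, and I Q_i consists of the functions with *)
(* all values in I.                                                           *)
Section Tor.
Variables (K : fieldType) (n : nat) (Q : residue_resolution K n).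
Variable I : {mpoly K[n]} -> Prop.

Definition chain_homog i (j : nat) (c : basis Q i -> {mpoly K[n]}) : Prop :=
  forall b, shifted_homog (shift b) j (c b).

Definition is_cycle i : (basis Q i -> {mpoly K[n]}) -> Prop :=
  match i return (basis Q i -> {mpoly K[n]}) -> Prop with
  | 0 => fun=> True
  | i'.+1 => fun c => forall b, I (matrix_map (@diff _ _ Q i') c b)
  end.

Definition is_boundary i (j : nat) (c : basis Q i -> {mpoly K[n]}) : Prop :=
  exists2 c', chain_homog j c' &
    forall b, I (c b - matrix_map (@diff _ _ Q i) c' b).

(* Tor_i(R/I, K)_j is nonzero. *)
Definition Tor_neq0 (i j : nat) : Prop :=
  exists c : basis Q i -> {mpoly K[n]},
    [/\ chain_homog j c, is_cycle c & ~ is_boundary j c].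
End Tor.

(* The Koszul complex on the variables, with its proof of exactness.  The     *)
(* generators of its i-th module are the sets e_S with #|S| = i, and          *)
(* d(e_S) is the sum over k in S of (-1)^#{l in S : l < k} x_k e_(S minus k). *)
Section Koszul.
Variables (K : fieldType) (n : nat).
Local Notation R := {mpoly K[n]}.
Implicit Types (S : {set 'I_n}) (k l p : 'I_n) (m : 'X_{1..n}).

Definition koszul_basis (i : nat) : finType := {S : {set 'I_n} | #|S| == i}.

Definition koszul_sign k S : K := (-1) ^+ #|[set l in S | (l < k)%N]|.

Definition koszul_diff i (b : koszul_basis i.+1) (b' : koszul_basis i) : R :=
  \sum_(k in val b | val b' == val b :\ k) koszul_sign k (val b) *: 'X_k.

Definition koszul_d (F : {set 'I_n} -> R) S : R :=
  \sum_(k | k \notin S) koszul_sign k S *: ('X_k * F (k |: S)).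

Definition koszul_ext i (c : koszul_basis i -> R) S : R := oapp c 0 (insub S).

Fact koszul_signU k S : koszul_sign k (k |: S) = koszul_sign k S.
Proof.
congr (_ ^+ _); apply: eq_card => l; rewrite !inE.
by case: eqP => [->|//]; rewrite ltnn !andbF.
Qed.

Fact koszul_signUlt k l S : (k < l)%N -> l \notin S ->
  koszul_sign k (l |: S) = koszul_sign k S.
Proof.
move=> kl lS; congr (_ ^+ _); apply: eq_card => h; rewrite !inE.
by case: eqP => [->|//]; rewrite ltnNge (ltnW kl) !andbF.
Qed.

Fact koszul_signUgt k l S : (l < k)%N -> l \notin S ->
  koszul_sign k (l |: S) = - koszul_sign k S.
Proof.
move=> lk lS; rewrite /koszul_sign.
suff -> : [set h in l |: S | (h < k)%N] = l |: [set h in S | (h < k)%N].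
  by rewrite cardsU1 inE (negPf lS) /= exprS mulN1r.
by apply/setP=> h; rewrite !inE; case: eqP => [->|//]; rewrite lk.
Qed.

Fact koszul_extE i (c : koszul_basis i -> R) (b : koszul_basis i) :
  koszul_ext c (val b) = c b.
Proof. by rewrite /koszul_ext valK. Qed.

Fact koszul_dE i (c : koszul_basis i.+1 -> R) (b : koszul_basis i) :
  matrix_map (@koszul_diff i) c b = koszul_d (koszul_ext c) (val b).
Proof.
rewrite /matrix_map /koszul_d /koszul_diff.
under eq_bigr do rewrite mulr_sumr big_mkcond /=.
rewrite exchange_big [RHS]big_mkcond /=; apply: eq_bigr => k _.
case: (boolP (k \in val b)) => kb /=.
  rewrite big1 // => b1 _; case: ifP => // /andP[_ /eqP E].
  by move: kb; rewrite [val b]E !inE eqxx.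
have cU : #|k |: val b| == i.+1 by rewrite cardsU1 kb (eqP (valP b)).
rewrite (bigD1 (Sub (k |: val b) cU)) //= [X in _ + X]big1 ?addr0.
  rewrite !inE eqxx setU1K // eqxx /= koszul_signU -scalerAr mulrC.
  congr (_ *: (_ * _)).
  by rewrite -(koszul_extE c (Sub (k |: val b) cU)).
move=> b1 nb1; case: ifP => // /andP[kb1 /eqP E].
by case/eqP: nb1; apply: val_inj; rewrite /= [sval b]E setD1K.
Qed.

Fact koszul_dd (F : {set 'I_n} -> R) S : koszul_d (koszul_d F) S = 0.
Proof.
pose A k l : R := if (k \notin S) && (l \notin k |: S) then
  koszul_sign k S *: ('X_k * (koszul_sign l (k |: S) *:
     ('X_l * F (l |: (k |: S))))) else 0.
have -> : koszul_d (koszul_d F) S = \sum_k \sum_l A k l.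
  rewrite /koszul_d big_mkcond /=; apply: eq_bigr => k _; rewrite /A.
  case: ifP => _ /=; last by rewrite big1.
  rewrite mulr_sumr scaler_sumr big_mkcond /=.
  by apply: eq_bigr => l _; case: ifP.
have AN k l : (k < l)%N -> A k l = - A l k.
  move=> kl; rewrite /A !inE !negb_or.
  have nkl : k != l by rewrite neq_ltn kl.
  rewrite nkl eq_sym nkl /=.
  case: (boolP (k \in S)) => kS /=; first by rewrite andbF oppr0.
  case: (boolP (l \in S)) => lS /=; first by rewrite oppr0.
  rewrite koszul_signUgt // (koszul_signUlt kl) //.
  rewrite setUA [l |: [set k]]setUC -setUA.
  rewrite -!scalerAr !scalerA mulrN scaleNr; congr (- (_ *: _)).
    by rewrite mulrC.
  by rewrite !mulrA ['X_k * _]mulrC.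
have Akk k : A k k = 0 by rewrite /A !inE eqxx andbF.
have split2 k : \sum_l A k l =
    \sum_(l : 'I_n | (k < l)%N) A k l + \sum_(l : 'I_n | (l < k)%N) A k l.
  rewrite (bigID (fun l : 'I_n => (k < l)%N)) /=; congr (_ + _).
  rewrite (bigD1 k) ?ltnn //= Akk add0r.
  by apply: eq_bigl => l; rewrite -leqNgt andbC -ltn_neqAle.
under eq_bigr do rewrite split2.
rewrite big_split /=.
have -> : \sum_(k : 'I_n) \sum_(l : 'I_n | (k < l)%N) A k l =
    - \sum_(k : 'I_n) \sum_(l : 'I_n | (l < k)%N) A k l.
  rewrite -sumrN [LHS](exchange_big_dep xpredT) //=.
  apply: eq_bigr => l _; rewrite -sumrN; apply: eq_bigr => k kl.
  exact: AN.
by rewrite addNr.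
Qed.

Fact koszul_coefMX k (f : R) m :
  ('X_k * f)@_m = if m k == 0%N then 0 else f@_(m - U_(k)).
Proof.
case: ifP => mk; last first.
  have le : (U_(k) <= m)%MM by rewrite lep1mP mk.
  by rewrite -[in LHS](submK le) ['X_k * f]mulrC addmC mcoeffMX.
rewrite [f]mpolyE mulr_sumr raddf_sum big1 //= => u _.
rewrite -scalerAr -mpolyXD mcoeffZ mcoeffX.
case: eqP => [E|_]; last by rewrite mulr0.
by move: mk; rewrite -E mnmDE mnm1E eqxx.
Qed.

Fact koszul_coef_d F S m : (koszul_d F S)@_m =
  \sum_(k | (k \notin S) && (m k != 0%N))
    koszul_sign k S * (F (k |: S))@_(m - U_(k)).
Proof.
rewrite /koszul_d raddf_sum [RHS]big_mkcondr /=; apply: eq_bigr => k _.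
by rewrite mcoeffZ koszul_coefMX; case: ifP; rewrite ?mulr0.
Qed.

Definition koszul_first p m S := [forall l : 'I_n, (l < p)%N ==> (l \notin S) && (m l == 0%N)].

Definition koszul_h (F : {set 'I_n} -> R) S : R :=
  \sum_(p in S) \sum_(u <- msupp (F (S :\ p)) | (u p != 0%N) && koszul_first p u S)
    (F (S :\ p))@_u *: 'X_[u - U_(p)].

Fact koszul_coef_h F S m : (koszul_h F S)@_m =
  \sum_(p in S | koszul_first p m S) (F (S :\ p))@_(m + U_(p)).
Proof.
rewrite /koszul_h raddf_sum /= [RHS]big_mkcondr /=; apply: eq_bigr => p pS.
rewrite raddf_sum /=; set G := F _.
have firstE : koszul_first p (m + U_(p))%MM S = koszul_first p m S.
  apply: eq_forallb => l; case: ltnP => //= lp.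
  by rewrite mnmDE mnm1E -val_eqE /= (gtn_eqF lp) addn0.
have mp : (m + U_(p))%MM p != 0%N by rewrite mnmDE mnm1E eqxx addn1.
under eq_bigr do rewrite mcoeffZ mcoeffX.
have neq u : u != (m + U_(p))%MM -> u p != 0%N -> (u - U_(p))%MM == m = false.
  move=> nu up; apply: contra_neqF nu => /eqP <-.
  by rewrite submK // lep1mP.
case: (boolP ((m + U_(p))%MM \in msupp G)) => ms; last first.
  rewrite (memN_msupp_eq0 ms) if_same big_seq_cond big1 // => u.
  move=> /and3P[us up _]; rewrite neq ?mulr0 //.
  by apply: contraNneq ms => <-.
rewrite big_mkcond (bigD1_seq _ ms (msupp_uniq _)) /= big1 ?addr0.
  by rewrite mp firstE /= addmK eqxx mulr1.
by move=> u nu; case: ifP => // /andP[up _]; rewrite neq ?mulr0.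
Qed.

Fact koszul_first_uniq p q m S m' S' :
  koszul_first p m S -> koszul_first q m' S' ->
  (p \in S') || (m' p != 0%N) -> (q \in S) || (m q != 0%N) -> p = q.
Proof.
move=> /forallP fp /forallP fq hp hq; apply: val_inj => /=.
case: (ltngtP p q) => // lt.
  by move: (implyP (fq p) lt) hp => /andP[/negPf -> /eqP ->].
by move: (implyP (fp q) lt) hq => /andP[/negPf -> /eqP ->].
Qed.

Fact koszul_sign_first p m S : koszul_first p m S -> koszul_sign p S = 1.
Proof.
move=> /forallP fp; rewrite /koszul_sign.
rewrite (_ : [set _ in _ | _] = set0) ?cards0 //.
apply/setP=> l; rewrite !inE; apply/negP => /andP[lS lp].
by have := implyP (fp l) lp; rewrite lS.
Qed.

Fact koszul_first_exists m S : S != set0 \/ m != 0%MM ->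
  exists2 p, koszul_first p m S & (p \in S) || (m p != 0%N).
Proof.
move=> h; have [p0 hp0] : exists p, (p \in S) || (m p != 0%N).
  case: h => [/set0Pn[p pS]|m0]; first by exists p; rewrite pS.
  apply/existsP; apply: contraNT m0; rewrite negb_exists => /forallP h.
  apply/eqP/mnmP => p; have := h p.
  by rewrite negb_or negbK mnm0E => /andP[_ /eqP].
case: (@arg_minnP _ p0 (fun p => (p \in S) || (m p != 0%N)) val hp0) => p hp le.
exists p => //; apply/forallP => l; apply/implyP => lp.
rewrite -[m l == _]negbK -negb_or; apply: contraTN lp => hl.
by rewrite -leqNgt le.
Qed.

(* [koszul_h] contracts the augmented complex in every nonzero multidegree.   *)
Fact koszul_homotopy F m S : (forall S', S' \proper S -> koszul_d F S' = 0) ->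
  S != set0 \/ m != 0%MM -> (F S)@_m = (koszul_d (koszul_h F) S)@_m.
Proof.
move=> dF0 /koszul_first_exists[p fp hp]; rewrite koszul_coef_d.
case: (boolP (p \in S)) => pS; last first.
  have mp : m p != 0%N by move: hp; rewrite (negPf pS).
  rewrite (bigD1 p) ?pS //= big1 ?addr0.
    rewrite (koszul_sign_first fp) mul1r koszul_coef_h.
    rewrite (bigD1 p) /= ?big1 ?addr0.
    - by rewrite setU1K // submK // lep1mP.
    - move=> q /andP[/andP[qS fq] nqp]; case/eqP: nqp; symmetry.
      apply: (koszul_first_uniq fp fq); first by rewrite !inE eqxx.
      move: qS; rewrite !inE => /orP[/eqP->|->//].
      by rewrite mp orbT.
    rewrite !inE eqxx /=; apply/forallP => l; apply/implyP => lp.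
    move: (implyP (forallP fp l) lp) => /andP[lS /eqP ml].
    by rewrite !inE negb_or lS mnmBE ml sub0n eqxx !andbT neq_ltn lp.
  move=> k /andP[/andP[kS mk] nkp]; rewrite koszul_coef_h big1 ?mulr0 // => q.
  move=> /andP[qS fq]; suff E : p = q.
    by move: qS; rewrite -E !inE (negPf pS) eq_sym (negPf nkp).
  apply: (koszul_first_uniq fp fq).
    by rewrite mnmBE mnm1E (negPf nkp) subn0 mp orbT.
  by move: qS; rewrite !inE => /orP[/eqP->|->//]; rewrite mk orbT.
have := congr1 (mcoeff (m + U_(p))) (dF0 (S :\ p) (properD1 pS)).
rewrite koszul_coef_d mcoeff0 (bigD1 p) /=; last first.
  by rewrite !inE eqxx mnmDE mnm1E eqxx addn1.
have fpS : koszul_first p m (S :\ p).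
  apply/forallP => l; apply/implyP => lp.
  move: (implyP (forallP fp l) lp) => /andP[lS ->].
  by rewrite !inE (negPf lS) andbF.
rewrite (koszul_sign_first fpS) mul1r addmK setD1K // => /eqP.
rewrite addr_eq0 => /eqP ->; rewrite -sumrN; symmetry.
apply: eq_big => [k|k /andP[kS mk]].
  rewrite !inE mnmDE mnm1E negb_and negbK.
  case: (eqVneq k p) => [->|nkp]; first by rewrite pS andbF.
  by rewrite /= addn0 andbT.
have nkp : k != p by apply: contraNneq kS => ->.
have pk : (p < k)%N.
  case: (ltngtP p k) => // [kp|E].
    by have := implyP (forallP fp k) kp; rewrite (negPf mk) andbF.
  by move: nkp; rewrite (val_inj E) eqxx.
have -> : koszul_sign k S = - koszul_sign k (S :\ p).
  by rewrite -{1}(setD1K pS) koszul_signUgt // !inE eqxx.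
rewrite mulNr; congr (- (_ * _)).
have fpk : koszul_first p (m - U_(k)) (k |: S).
  apply/forallP => l; apply/implyP => lp.
  move: (implyP (forallP fp l) lp) => /andP[lS /eqP ml].
  rewrite !inE negb_or lS mnmBE ml sub0n eqxx !andbT.
  by rewrite neq_ltn (ltn_trans lp pk).
rewrite koszul_coef_h (bigD1 p) /= ?big1 ?addr0.
- congr ((F _)@_ _).
    apply/mnmP => l; rewrite mnmDE !mnmBE mnmDE !mnm1E.
    case: (eqVneq k l) => [<-|_]; last by rewrite !subn0.
    by rewrite [p == k]eq_sym (negPf nkp) !addn0.
  apply/setP => l; rewrite !inE.
  by case: (eqVneq l k) => [->|]; rewrite ?nkp.
- move=> q /andP[/andP[qS fq] nqp]; case/eqP: nqp; symmetry.
  apply: (koszul_first_uniq fpk fq); first by rewrite !inE pS orbT.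
  by rewrite qS.
by rewrite !inE pS orbT.
Qed.

Fact koszul_d_eq F G S :
  (forall k, k \notin S -> F (k |: S) = G (k |: S)) ->
  koszul_d F S = koszul_d G S.
Proof. by move=> FG; apply: eq_bigr => k kS; rewrite FG. Qed.

Fact koszul_ext0 i (c : koszul_basis i -> R) S :
  #|S| != i -> koszul_ext c S = 0.
Proof. by move=> Si; rewrite /koszul_ext insubN. Qed.

Fact koszul_d_ext0 i (c : koszul_basis i.+1 -> R) S :
  #|S| != i -> koszul_d (koszul_ext c) S = 0.
Proof.
move=> Si; rewrite /koszul_d big1 // => k kS.
by rewrite koszul_ext0 ?mulr0 ?scaler0 // cardsU1 kS.
Qed.

Fact koszul_ext_map i (c : koszul_basis i.+1 -> R) :
  koszul_ext (matrix_map (@koszul_diff i) c) =1 koszul_d (koszul_ext c).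
Proof.
move=> S; case: (eqVneq #|S| i) => [/eqP Si|Si].
  by rewrite -[S]/(val (Sub S Si : koszul_basis i)) koszul_extE koszul_dE.
by rewrite koszul_ext0 // koszul_d_ext0.
Qed.

Fact koszul_map_h i (c : koszul_basis i -> R) (b : koszul_basis i) :
  matrix_map (@koszul_diff i) (fun b' => koszul_h (koszul_ext c) (val b')) b =
  koszul_d (koszul_h (koszul_ext c)) (val b).
Proof.
rewrite koszul_dE; apply: koszul_d_eq => k kb.
have Ub : #|k |: val b| == i.+1 by rewrite cardsU1 kb (eqP (valP b)).
by rewrite -[k |: val b]/(val (Sub (k |: val b) Ub : koszul_basis i.+1)) koszul_extE.
Qed.

Fact koszul_diff_exact i (c : koszul_basis i.+1 -> R) :
  (matrix_map (@koszul_diff i) c =1 fun=> 0) <->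
  (exists c', c =1 matrix_map (@koszul_diff i.+1) c').
Proof.
split=> [c0|[c' cE] b]; last first.
  rewrite koszul_dE -[RHS](koszul_dd (koszul_ext c') (val b)).
  apply: koszul_d_eq => k kb.
  have Ub : #|k |: val b| == i.+1 by rewrite cardsU1 kb (eqP (valP b)).
  by rewrite -koszul_ext_map /koszul_ext insubT /= cE.
exists (fun b' => koszul_h (koszul_ext c) (val b')) => b.
rewrite koszul_map_h -[LHS](koszul_extE c b); apply/mpolyP => m.
apply: koszul_homotopy => [S' _|].
  by rewrite -koszul_ext_map /koszul_ext; case: insub => //= b'; rewrite c0.
by left; rewrite -card_gt0 (eqP (valP b)).
Qed.

Definition koszul_aug (b : koszul_basis 0) : K := 1.

Definition koszul_basis0 : koszul_basis 0 :=
  Sub (set0 : {set 'I_n}) (introT eqP (cards0 _)).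

Fact koszul_basis0_eq (b : koszul_basis 0) : b = koszul_basis0.
Proof. by apply: val_inj; apply/eqP; rewrite /= -cards_eq0 (valP b). Qed.

Fact koszul_augE (c : koszul_basis 0 -> R) :
  augment koszul_aug c = (c koszul_basis0)@_0%MM.
Proof.
rewrite /augment (bigD1 koszul_basis0) //= big1 ?addr0 ?mulr1 // => b.
by rewrite [b]koszul_basis0_eq eqxx.
Qed.

Fact koszul_aug_exact (c : koszul_basis 0 -> R) :
  augment koszul_aug c = 0 <->
  (exists c', c =1 matrix_map (@koszul_diff 0) c').
Proof.
rewrite koszul_augE; split=> [c0|[c' ->]]; last first.
  rewrite koszul_dE koszul_coef_d big1 // => k.
  by rewrite mnm0E andbF.
exists (fun b' => koszul_h (koszul_ext c) (val b')) => b.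
rewrite koszul_map_h -[LHS](koszul_extE c b); apply/mpolyP => m.
rewrite [b]koszul_basis0_eq /=.
case: (eqVneq m 0%MM) => [->|m0]; last first.
  by apply: koszul_homotopy; [move=> S' /properP[_ [? ]]; rewrite inE | right].
rewrite -[set0]/(val koszul_basis0) koszul_extE c0 koszul_coef_d big1 // => k.
by rewrite mnm0E andbF.
Qed.

Fact koszul_aug_surj (a : K) :
  exists c : koszul_basis 0 -> R, augment koszul_aug c = a.
Proof.
exists (fun=> a%:MP); rewrite koszul_augE mcoeffC eqxx mulr1; by [].
Qed.

Fact koszul_diff_homog i (b : koszul_basis i.+1) (b' : koszul_basis i) :
  shifted_homog i i.+1 (koszul_diff b b').
Proof.
rewrite /shifted_homog leqnSn subSnn; apply: rpred_sum => k _.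
by apply: rpredZ; rewrite dhomogX; apply/eqP; apply: mdeg1.
Qed.

Definition koszul_resolution : residue_resolution K n :=
  @ResidueResolution K n koszul_basis (fun i _ => i) koszul_diff koszul_aug
    koszul_diff_homog (fun _ _ => erefl) koszul_diff_exact koszul_aug_exact
    koszul_aug_surj.

End Koszul.

(* [r] is the maximum of { j - i : Tor_i(R/I, K)_j <> 0 }.                    *)
Definition is_reg_quot (K : fieldType) (n : nat) (I : {mpoly K[n]} -> Prop)
    (r : int) : Prop :=
  (exists i j : nat,
     Tor_neq0 (koszul_resolution K n) I i j /\ r = j%:Z - i%:Z) /\
  (forall i j : nat,
     Tor_neq0 (koszul_resolution K n) I i j -> j%:Z - i%:Z <= r).

(* reg(R/I).  The maximum exists for every proper homogeneous ideal I; the    *)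
(* value is unspecified when it does not exist, as for I = R.                 *)
Definition reg_quot (K : fieldType) (n : nat) (I : {mpoly K[n]} -> Prop) : int :=
  epsilon (inhabits (0 : int)) (is_reg_quot I).

(* Main.v *)
From Stdlib Require Import ClassicalEpsilon.
Require Import Defs.
From mathcomp Require Import all_boot all_order all_algebra.
From mathcomp Require Import mpoly ring zify.

(** The ideals of the theorem are squarefree monomial ideals, so they are
    Stanley-Reisner ideals: each is given by the simplicial complex D of the
    sets of variables that contain no generator.  The Koszul complex of R/I
    splits by multidegree.  Its part in a squarefree multidegree W is, up to
    signs, the cochain complex of the induced subcomplex D[W], and in any other
    multidegree that part is the cochain complex of a cone, which is acyclic.
    With cohomology graded by the number of elements of a face, which is one
    more than its dimension, this is Hochster's formula
      Tor_i(R/I)_W = H^(|W|-i)(D[W]),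
    and it makes reg(R/I) the Leray number of D: the least r such that no
    induced subcomplex has cohomology on faces with more than r elements
    ([not_Tor_of_acyclic], [Tor_of_not_acyclic], [reg_quot_leray]).

    Let D be the complex of H, s = {x_1, ..., x_d} and e = s + x.  Adding
    x_1 ... x_d to the ideal removes from D the faces that contain s, and
    contracting s replaces D by the link of s, up to a cone over s.  The long
    exact sequence
      H^(k-1)(D - s) -> H^(k-d)(link s) -> H^k(D) -> H^k(D - s)
    bounds each of the Leray numbers of D and of D - s by the two other terms
    ([acyclic_of_link], [acyclic_deletion_face]).  For the equality (i) one
    still needs that a cohomology class of the link of s produces one of D, d
    degrees higher.  Here simpliciality enters: if F + s is a face, then so is
    F + (e - y) for each y in s, because an edge inside F + (e - y) contains x,
    and eliminating x between this edge and e leaves an edge inside F + s.  So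
    D contains the join of the link of s with the boundary sphere of e, and
    pairing with this sphere is a left inverse, up to sign, of the map from
    the cohomology of the link to that of D ([acyclic_link_of_simplicial]).

    For (ii) the complex D - s is the union of the vertex deletions D - x_i.
    The union for x_2, ..., x_d meets D - x_1 in an induced subcomplex of
    itself, so by Mayer-Vietoris each further vertex raises the Leray number by
    at most one ([leray_deletion_face]).  This gives the maximum of the
    reg(R/I(H - x_i)) plus d - 1, and the regularities are nonnegative, so the
    maximum is at most the sum. *)
Set Implicit Arguments.
Unset Strict Implicit.
Unset Printing Implicit Defensive.
Import Order.TTheory GRing.Theory Num.Theory.
Local Open Scope ring_scope.

(** * Signed coboundaries of functions on sets *)

Section Cochains.
Variables (K : fieldType) (n : nat).
Implicit Types (A B F G W s : {set 'I_n}) (f g h : {set 'I_n} -> K).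
Implicit Types (D : pred {set 'I_n}).

Lemma setD1_notin k A : k \notin A -> A :\ k = A.
Proof. by move=> kA; apply/setDidPl; rewrite disjoint_sym disjoints1. Qed.

Lemma setUDK A B : A \subset B -> A :|: B :\: A = B.
Proof.
move=> /subsetP AB; apply/setP=> k; rewrite !inE.
by have := AB k; case: (k \in A) => //= ->.
Qed.

Lemma disjoint_setD A B : [disjoint A & B :\: A].
Proof. by rewrite disjoints_subset; apply/subsetP=> k; rewrite !inE => ->. Qed.

(** The sign of the shuffle that sorts [A] followed by [B].  Being
    multiplicative in both arguments, it reduces sign computations with faces
    built from several blocks to commutative algebra. *)
Definition eps A B : K := \prod_(a in A) \prod_(b in B) (-1) ^+ (b < a)%N.

Lemma epsUl A A' B : [disjoint A & A'] -> eps (A :|: A') B = eps A B * eps A' B.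
Proof. by move=> AA'; rewrite /eps -bigU //=; apply: eq_bigl => a; rewrite !inE. Qed.

Lemma epsUr A B B' : [disjoint B & B'] -> eps A (B :|: B') = eps A B * eps A B'.
Proof.
move=> BB'; rewrite /eps -big_split /=; apply: eq_bigr => a _; rewrite -bigU //=.
by apply: eq_bigl => b; rewrite !inE.
Qed.

Lemma eps_sq A B : eps A B * eps A B = 1.
Proof.
rewrite -big_split big1 // => a _; rewrite -big_split big1 // => b _ /=.
by rewrite -exprD addnn -signr_odd odd_double.
Qed.

Lemma epsC A B : [disjoint A & B] -> eps A B * eps B A = (-1) ^+ (#|A| * #|B|)%N.
Proof.
move=> AB; rewrite /eps [X in _ * X]exchange_big -big_split /=.
rewrite mulnC exprM -[RHS]prodr_const; apply: eq_bigr => a aA.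
rewrite -big_split /= -[RHS]prodr_const; apply: eq_bigr => b bB.
have : a != b by apply: contraTneq aA => ->; rewrite (disjointFl AB).
rewrite -exprD -val_eqE /=; case: ltngtP => //= _ _; exact: expr1.
Qed.

Lemma eps0l B : eps set0 B = 1.
Proof. by rewrite /eps big_set0. Qed.

Lemma eps1E k B : eps [set k] B = koszul_sign K k B.
Proof.
rewrite /eps big_set1 /koszul_sign prodrXr /= -sum1dep_card big_mkcondr /=.
by congr (_ ^+ _); apply: eq_bigr => b _; case: ltnP.
Qed.

Lemma eps11 k : eps [set k] [set k] = 1.
Proof. by rewrite /eps !big_set1 ltnn. Qed.

Lemma eps1D1 k B : eps [set k] (B :\ k) = eps [set k] B.
Proof.
have [kB|kB] := boolP (k \in B); last by rewrite setD1_notin.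
rewrite -[in RHS](setD1K kB) epsUr ?eps11 ?mul1r //.
by rewrite disjoints1 !inE eqxx.
Qed.

Lemma epsD1l k A B : k \in A -> eps A B = eps [set k] B * eps (A :\ k) B.
Proof.
by move=> kA; rewrite -{1}(setD1K kA) epsUl // disjoints1 !inE eqxx.
Qed.

Definition cobound f F : K := \sum_(k in F) eps [set k] F * f (F :\ k).

Lemma eq_cobound f g F : (forall k, k \in F -> f (F :\ k) = g (F :\ k)) ->
  cobound f F = cobound g F.
Proof. by move=> fg; apply: eq_bigr => k kF; rewrite fg. Qed.

Lemma coboundD f g F : cobound (fun F => f F + g F) F = cobound f F + cobound g F.
Proof. by rewrite -big_split; apply: eq_bigr => k _; rewrite mulrDr. Qed.

Lemma coboundZ c f F : cobound (fun F => c * f F) F = c * cobound f F.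
Proof. by rewrite mulr_sumr; apply: eq_bigr => k _; rewrite mulrCA. Qed.

(** Removing two elements in the two possible orders gives opposite signs.  The
    sum is split by the order of the pair, because in characteristic 2 a sum
    equal to its opposite need not vanish. *)
Lemma cobound_cobound f F : cobound (cobound f) F = 0.
Proof.
pose B k l : K := eps [set k] F * eps [set l] (F :\ k) * f (F :\ k :\ l).
have BN k l : k \in F -> l \in F -> k != l -> B k l = - B l k.
  move=> kF lF kl; rewrite /B (_ : F :\ l :\ k = F :\ k :\ l); last by rewrite !setDDl setUC.
  rewrite -mulNr; congr (_ * _).
  have E a b : a \in F -> b \in F -> a != b -> eps [set a] F =
      eps [set a] [set b] * eps [set a] (F :\ b).
    move=> aF bF _; rewrite -{1}(setD1K bF) epsUr //.
    by rewrite disjoints1 !inE eqxx.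
  have kl' := epsC (A := [set k]) (B := [set l]).
  rewrite (E k l) // (E l k) 1?eq_sym //.
  have {}kl' : eps [set k] [set l] = - eps [set l] [set k].
    have := kl' _; rewrite disjoints1 inE kl !cards1 muln1 expr1 => /(_ isT) H.
    by rewrite -[LHS]mulr1 -(eps_sq [set l] [set k]) mulrA H mulN1r.
  rewrite kl'; ring.
rewrite /cobound; under eq_bigr do rewrite mulr_sumr.
have -> : \sum_(k in F) \sum_(l in F :\ k) eps [set k] F *
   (eps [set l] (F :\ k) * f (F :\ k :\ l)) =
   \sum_(k in F) \sum_(l in F | l != k) B k l.
  apply: eq_bigr => k kF; apply: eq_big => [l|l _]; last by rewrite /B mulrA.
  by rewrite !inE andbC.
have spl k : \sum_(l in F | l != k) B k l =
    \sum_(l in F | (k < l)%N) B k l + \sum_(l in F | (l < k)%N) B k l.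
  rewrite (bigID (fun l : 'I_n => (k < l)%N)) /=; congr (_ + _).
    apply: eq_bigl => l; rewrite -andbA; congr (_ && _).
    by rewrite -val_eqE /=; case: ltngtP.
  apply: eq_bigl => l; rewrite -andbA; congr (_ && _).
  by rewrite -val_eqE /=; case: ltngtP.
under eq_bigr do rewrite spl.
rewrite big_split /= [X in X + _](exchange_big_dep (mem F)) /=; last first.
  by move=> k l _ /andP[].
rewrite -big_split big1 //= => l lF.
rewrite (eq_bigl (fun k : 'I_n => (k \in F) && (k < l)%N)); last first.
  by move=> k; rewrite lF.
rewrite -big_split big1 //= => k /andP[kF kl].
by rewrite BN ?addNr // -val_eqE neq_ltn kl.
Qed.

(** [slice s] sends cochains of a complex to cochains of the link of [s];
    [extend s] goes back, with value zero on the sets that do not contain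
    [s]. *)
Definition slice s f G : K := eps s G * f (s :|: G).
Definition extend s h F : K := if s \subset F then eps s (F :\: s) * h (F :\: s) else 0.

Lemma slice_extend s h G : [disjoint s & G] -> slice s (extend s h) G = h G.
Proof.
move=> sG; rewrite /slice /extend subsetUl.
have -> : (s :|: G) :\: s = G.
  by rewrite setDUl setDv set0U; apply/setDidPl; rewrite disjoint_sym.
by rewrite mulrA eps_sq mul1r.
Qed.

Lemma eps1_swap k s : k \notin s -> eps [set k] s = (-1) ^+ #|s| * eps s [set k].
Proof.
move=> ks; have := @epsC [set k] s; rewrite disjoints1 ks cards1 mul1n => /(_ isT) <-.
by rewrite -mulrA eps_sq mulr1.
Qed.

Lemma eps_add1r k s G : k \in G -> eps s G = eps s [set k] * eps s (G :\ k).
Proof. by move=> kG; rewrite -{1}(setD1K kG) epsUr // disjoints1 !inE eqxx. Qed.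

Lemma cobound_extend s h F :
  cobound (extend s h) F = (-1) ^+ #|s| * extend s (cobound h) F.
Proof.
rewrite {2}/extend; case: ifPn => [sF|sF]; last first.
  rewrite mulr0; apply: big1 => k _; rewrite /extend ifN ?mulr0 //.
  by apply: contraNN sF => /subset_trans; apply; exact: subD1set.
rewrite /cobound mulr_sumr mulr_sumr.
rewrite (bigID (fun k => k \in s)) /= big1 ?add0r; last first.
  move=> k /andP[kF ks]; rewrite /extend ifN ?mulr0 //.
  by apply/negP => /subsetP/(_ k ks); rewrite !inE eqxx.
apply: eq_big => [k|k /andP[kF ks]]; first by rewrite inE andbC.
have sFk : s \subset F :\ k by rewrite subsetD1 sF ks.
rewrite /extend sFk.
have -> : F :\ k :\: s = (F :\: s) :\ k by rewrite !setDDl setUC.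
have kFs : k \in F :\: s by rewrite inE ks.
rewrite (eps_add1r s kFs).
have -> : eps [set k] F = eps [set k] s * eps [set k] (F :\: s).
  by rewrite -epsUr ?setUDK // disjoint_setD.
by rewrite (eps1_swap ks); ring.
Qed.

(** The elements removed from [s :|: G] lie in [G] or in [s].  The second sum is
    the pairing of [f] with the boundary of the simplex [s]. *)
Lemma slice_cobound s f G : [disjoint s & G] ->
  slice s (cobound f) G = (-1) ^+ #|s| * cobound (slice s f) G +
     \sum_(k in s) eps [set k] s * slice (s :\ k) f G.
Proof.
move=> sG; rewrite /slice {1}/cobound mulr_sumr.
rewrite (eq_bigl (fun k => (k \in s) || (k \in G))); last by move=> k; rewrite inE.
rewrite bigU //= addrC; congr (_ + _).
  rewrite /cobound mulr_sumr; apply: eq_bigr => k kG.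
  have ks : k \notin s by rewrite (disjointFl sG).
  rewrite epsUr // (eps_add1r s kG) (eps1_swap ks) setDUl.
  by rewrite (setD1_notin ks) -[RHS]mul1r -(eps_sq s [set k]); ring.
apply: eq_bigr => k ks.
have kG : k \notin G by rewrite (disjointFr sG).
rewrite epsUr // (epsD1l _ ks) setDUl (setD1_notin kG).
by rewrite -[RHS]mul1r -(eps_sq [set k] G); ring.
Qed.
End Cochains.

(** * Acyclic families of sets *)

Section Acyclic.
Variables (K : fieldType) (n : nat).
Implicit Types (A B F G W s : {set 'I_n}) (f g h : {set 'I_n} -> K).
Implicit Types (D : pred {set 'I_n}).

(** Vanishing of the cohomology of [D] on faces with [k] elements.  Cochains are
    functions on all sets of which only the values on [D] matter, which saves
    restriction maps. *)
Definition acyclic D k : Prop := forall f,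
  (forall F, D F -> #|F| = k.+1 -> cobound f F = 0) ->
  exists g, forall F, D F -> #|F| = k -> f F = cobound g F.

Definition down_closed D := forall F G, G \subset F -> D F -> D G.
Definition restrict D W : pred {set 'I_n} := fun F => D F && (F \subset W).
Definition deletion_face D s : pred {set 'I_n} := fun F => D F && ~~ (s \subset F).
Definition link D s : pred {set 'I_n} := fun G => [disjoint s & G] && D (s :|: G).

(** The trace on the complex of independent sets of the simpliciality of [x],
    for the edge [x |: s]. *)
Definition exchange D s x := forall F y, [disjoint s & F] -> D (s :|: F) ->
  y \in s -> D (((x |: s) :\ y) :|: F).

Lemma eq_acyclic D D' k : D =1 D' -> acyclic D k -> acyclic D' k.
Proof.
move=> E ac f fz; have [|g gP] := ac f; first by move=> F; rewrite E; exact: fz.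
by exists g => F; rewrite -E; exact: gP.
Qed.

Lemma acyclic_empty D k : (forall F, D F -> #|F| != k) -> acyclic D k.
Proof. by move=> D0 f _; exists f => F /D0 /eqP. Qed.

(** Slicing at the apex is a contracting homotopy. *)
Lemma acyclic_cone D p k : (forall F, D F -> D (p |: F)) -> down_closed D ->
  acyclic D k.
Proof.
move=> Dp Dd f fz.
exists (fun G => if p \in G then 0 else eps K [set p] G * f (p |: G)) => F DF Fk.
have [pF|pF] := boolP (p \in F).
  rewrite /cobound (bigD1 p) //= big1 ?addr0; last first.
    by move=> k' /andP[_ kp]; rewrite !inE eq_sym kp pF mulr0.
  by rewrite !inE eqxx /= eps1D1 mulrA eps_sq mul1r setD1K.
have dpF : [disjoint [set p] & F] by rewrite disjoints1.
have := @slice_cobound K n [set p] f F dpF.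
rewrite /slice cards1 expr1 big_set1 setDv set0U eps0l mul1r eps11 mul1r.
rewrite fz ?mulr0; last 2 first.
- exact: Dp.
- by rewrite cardsU1 pF Fk.
move=> /eqP; rewrite eq_sym addrC mulN1r subr_eq0 => /eqP ->.
apply: eq_cobound => k' k'F; rewrite ifN //.
by rewrite !inE negb_and pF orbT.
Qed.

Lemma link_disjoint D s G : link D s G -> [disjoint s & G].
Proof. by case/andP. Qed.

Lemma card_face s G : [disjoint s & G] -> #|s :|: G| = (#|s| + #|G|)%N.
Proof. by move=> sG; rewrite cardsU disjoint_setI0 // cards0 subn0. Qed.

Section LinkSequence.
Variables (D : pred {set 'I_n}) (s : {set 'I_n}).
Hypothesis Dd : down_closed D.

Lemma deletion_faceD1 G k : link D s G -> k \in s ->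
  deletion_face D s ((s :\ k) :|: G).
Proof.
case/andP=> sG DsG ks; apply/andP; split.
  by apply: Dd DsG; apply: setSU; exact: subD1set.
apply/negP => /subsetP/(_ k ks); rewrite !inE eqxx /=.
by rewrite (disjointFr sG).
Qed.

Lemma card_faceD1 G k : link D s G -> k \in s ->
  #|(s :\ k) :|: G| = (#|s| + #|G|).-1%N.
Proof.
move=> /andP[sG _] ks; rewrite card_face; last first.
  by apply: disjointWl sG; exact: subD1set.
by rewrite (cardsD1 k s) ks.
Qed.

Lemma link_setD F : D F -> s \subset F -> link D s (F :\: s).
Proof. by move=> DF sF; rewrite /link disjoint_setD setUDK. Qed.

Lemma card_link F : s \subset F -> #|F :\: s| = (#|F| - #|s|)%N.
Proof. by move=> sF; rewrite cardsD (setIidPr sF). Qed.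

(** In [slice_cobound] the terms that leave [s] vanish, as they only involve
    faces that do not contain [s]. *)
Lemma slice_cocycle f k : (forall F, deletion_face D s F -> #|F| = k -> f F = 0) ->
  (forall F, D F -> #|F| = k.+1 -> cobound f F = 0) ->
  forall G, link D s G -> (#|s| + #|G|)%N = k.+1 -> cobound (slice s f) G = 0.
Proof.
move=> f0 fz G lG Gk; have sG := link_disjoint lG.
have := slice_cobound f sG.
rewrite {1}/slice fz ?mulr0; last 2 first.
- by case/andP: lG.
- by rewrite card_face.
rewrite [X in _ + X]big1 ?addr0; last first.
  move=> y ys; rewrite /slice f0 ?mulr0 //; first exact: deletion_faceD1.
  by rewrite card_faceD1 // Gk.
by move/esym/eqP; rewrite mulf_eq0 signr_eq0 => /eqP.
Qed.


Lemma extend_slice f F : s \subset F -> extend s (slice s f) F = f F.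
Proof. by move=> sF; rewrite /extend /slice sF mulrA eps_sq mul1r setUDK. Qed.

Lemma extend_nsub h F : ~~ (s \subset F) -> extend s h F = 0.
Proof. by rewrite /extend => /negPf ->. Qed.

Lemma cobound_extend_slice h f F : s \subset F ->
  slice s f (F :\: s) = cobound h (F :\: s) ->
  (-1) ^+ #|s| * cobound (extend s h) F = f F.
Proof.
move=> sF E; rewrite cobound_extend mulrA -exprD addnn -signr_odd odd_double mul1r.
by rewrite -[RHS](extend_slice f sF) /extend sF E.
Qed.

(** Exactness of the sequence of the pair at [H^k(D)]: a cocycle [f] is cobounded
    by some [g] away from [s], and [f - cobound g] comes from the link. *)
Lemma acyclic_of_link k : acyclic (deletion_face D s) k ->
  (forall k', (k' + #|s|)%N = k -> acyclic (link D s) k') -> acyclic D k.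
Proof.
move=> acD acl f fz.
have [|g gP] := acD f; first by move=> F /andP[DF _]; exact: fz.
have [ks|sk] := ltnP k #|s|.
  exists g => F DF Fk; apply: gP => //; rewrite /deletion_face DF /=.
  by apply/negP => /subset_leq_card; rewrite Fk leqNgt ks.
pose f1 F := f F + -1 * cobound g F.
have f10 F : deletion_face D s F -> #|F| = k -> f1 F = 0.
  by move=> DF Fk; rewrite /f1 mulN1r -gP // subrr.
have f1z F : D F -> #|F| = k.+1 -> cobound f1 F = 0.
  by move=> DF Fk; rewrite coboundD coboundZ cobound_cobound fz // mulr0 addr0.
have [|h hP] := acl (k - #|s|)%N (subnK sk) (slice s f1).
  move=> G lG Gk; apply: (slice_cocycle f10 f1z lG).
  by rewrite Gk addnS subnKC.
exists (fun F => g F + (-1) ^+ #|s| * extend s h F) => F DF Fk.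
rewrite coboundD coboundZ.
have [sF|sF] := boolP (s \subset F); last first.
  rewrite cobound_extend extend_nsub // !mulr0 addr0 gP //.
  by rewrite /deletion_face DF.
rewrite (@cobound_extend_slice _ f1) //; first by rewrite /f1; ring.
by apply: hP; [exact: link_setD | rewrite card_link // Fk].
Qed.

(** Exactness at the deletion: the coboundary on [D] of a cocycle of the deletion
    lives on the faces that contain [s], hence in the link.  Cobounding it there
    corrects the cochain to a cocycle of [D]. *)
Lemma acyclic_deletion_face k : acyclic D k ->
  (forall k', (k' + #|s|)%N = k.+1 -> acyclic (link D s) k') ->
  acyclic (deletion_face D s) k.
Proof.
move=> acD acl f fz.
have [h hP] : exists h, forall F, D F -> #|F| = k.+1 -> s \subset F ->
    slice s (cobound f) (F :\: s) = cobound h (F :\: s).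
  have [ks|sk] := ltnP k.+1 #|s|.
    exists f => F DF Fk sF; move: ks.
    by rewrite ltnNge -Fk subset_leq_card.
  have [|h hP] := acl (k.+1 - #|s|)%N (subnK sk) (slice s (cobound f)).
    move=> G lG Gk; apply: (@slice_cocycle _ k.+1) lG _ => //.
      by move=> F _ _; exact: cobound_cobound.
    by rewrite Gk addnS subnKC.
  exists h => F DF Fk sF; apply: hP; first exact: link_setD.
  by rewrite card_link // Fk.
pose f1 F := f F + - (-1) ^+ #|s| * extend s h F.
have [|g gP] := acD f1.
  move=> F DF Fk; rewrite /f1 coboundD coboundZ mulNr.
  have [sF|sF] := boolP (s \subset F); last first.
    rewrite cobound_extend extend_nsub // !mulr0 subr0 fz //.
    by rewrite /deletion_face DF.
  by rewrite (@cobound_extend_slice _ (cobound f)) ?subrr // hP.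
exists g => F /andP[DF sF] Fk; rewrite -gP // /f1 extend_nsub //.
by rewrite mulr0 addr0.
Qed.
End LinkSequence.

(** If the cocycle [z] of the link, extended to [D], is the coboundary of [g],
    then pairing [g] with the boundary of the simplex [x |: s] cobounds [z]: of
    all facets of [x |: s] only [s] itself sees the extension of [z], and
    [exchange] ensures that the other facets join with the link inside [D]. *)
Lemma acyclic_link_of_simplicial D s x W k :
  x \notin s -> [disjoint x |: s & W] -> down_closed D -> ~~ D (x |: s) ->
  exchange D s x ->
  acyclic (restrict D ((x |: s) :|: W)) (k + #|s|) ->
  acyclic (link (restrict D (s :|: W)) s) k.
Proof.
set e := x |: s => xs eW Dd De Dx ac z zz.
have xe : x \in e by rewrite !inE eqxx.
have se : s \subset e by apply: subsetUr.
have exs : e :\ x = s by rewrite setU1K.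
have sW : s \subset s :|: W by exact: subsetUl.
have lkW G : [disjoint s & G] -> s :|: G \subset s :|: W -> G \subset W.
  move=> sG; rewrite subUset => /andP[_ /subsetP GW]; apply/subsetP => y yG.
  by have := GW y yG; rewrite inE (disjointFl sG).
have [|g gP] := ac (extend s z).
  move=> F /andP[DF FW] Fk; rewrite cobound_extend.
  have [sF|sF] := boolP (s \subset F); last by rewrite extend_nsub // mulr0.
  rewrite /extend sF zz ?mulr0 //.
    rewrite /link disjoint_setD setUDK //= /restrict DF /=.
    apply/subsetP => y yF; have := subsetP FW y yF.
    rewrite /e !inE -orbA; case: eqP => //= yx.
    case/negP: De; apply: Dd DF; rewrite subUset sF andbT sub1set -yx.
    exact: yF.
  by rewrite card_link // Fk -addSn addnK.
(* The pairing with the boundary of [e]; by [slice_cobound] it differs from a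
   slice of [cobound g] by a coboundary. *)
pose h G := \sum_(y in e) eps K [set y] e * slice (e :\ y) g G.
exists (fun G => - (-1) ^+ #|e| * eps K [set x] e * h G) => G /andP[sG /andP[DsG sGW]] Gk.
have GW := lkW _ sG sGW.
have eG : [disjoint e & G] by apply: disjointWr eW.
rewrite coboundZ.
have hE G' : G' \subset G -> h G' = slice e (cobound g) G' + - (-1) ^+ #|e| * cobound (slice e g) G'.
  move=> G'G; rewrite slice_cobound; last by apply: disjointWr eG.
  by rewrite /h; ring.
rewrite (eq_cobound (g := fun G' => slice e (cobound g) G' + - (-1) ^+ #|e| * cobound (slice e g) G')); last first.
  by move=> y _; apply: hE; exact: subD1set.
rewrite coboundD coboundZ cobound_cobound mulr0 addr0.
have := slice_cobound (cobound g) eG.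
rewrite {1}/slice cobound_cobound mulr0.
rewrite (bigD1 x) //= big1 ?addr0; last first.
  move=> y /andP[ye yx]; rewrite /slice -gP.
  - rewrite extend_nsub ?mulr0 //; apply/negP => /subsetP/(_ y).
    have ys : y \in s by move: ye; rewrite !inE (negPf yx).
    by rewrite !inE ys eqxx (disjointFr eG ye) => /(_ isT).
  - apply/andP; split.
      by apply: Dx => //; move: ye; rewrite !inE (negPf yx).
    by apply: setUSS GW; exact: subD1set.
  - rewrite card_face; last by apply: disjointWl eG; exact: subD1set.
    rewrite addnC Gk. congr (_ + _)%N.
    by have := cardsD1 y e; rewrite ye (cardsD1 x e) xe exs => /addnI ->.
rewrite exs.
have -> : slice s (cobound g) G = z G.
  rewrite -(slice_extend z sG) /slice -gP //.
  - apply/andP; split=> //.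
    by apply: setUSS GW.
  - by rewrite card_face // Gk addnC.
move=> /esym/eqP; rewrite addr_eq0 => /eqP E.
rewrite -mulrA mulrCA mulNr E opprK mulrA eps_sq mul1r; by [].
Qed.

(** Mayer-Vietoris: cochains that cobound on the two pieces differ on the
    intersection by a coboundary, after which they can be glued. *)
Lemma acyclicU D1 D2 k : acyclic D1 k -> acyclic D2 k ->
  (forall k', k'.+1 = k -> acyclic (fun F => D1 F && D2 F) k') ->
  down_closed D1 -> down_closed D2 ->
  acyclic (fun F => D1 F || D2 F) k.
Proof.
move=> ac1 ac2 ac12 D1d D2d f fz.
have [|g1 g1P] := ac1 f; first by move=> F DF; apply: fz; rewrite DF.
have [|g2 g2P] := ac2 f; first by move=> F DF; apply: fz; rewrite DF orbT.
case: k => [|k] in ac1 ac2 ac12 fz g1P g2P *.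
  exists g1 => F /orP[DF|DF] Fk; [exact: g1P|rewrite g2P //].
  by move/eqP: Fk; rewrite cards_eq0 => /eqP ->; rewrite /cobound !big_set0.
have [|h hP] := ac12 k erefl (fun F => g1 F + -1 * g2 F).
  move=> F /andP[DF1 DF2] Fk; rewrite coboundD coboundZ -g1P // -g2P //.
  by rewrite mulN1r subrr.
(* By the choice of [h] the two cases agree on the faces common to [D1] and
   [D2] that have [k] elements. *)
exists (fun F => if D1 F then g1 F else g2 F + cobound h F) => F DF Fk.
have [DF1|DF1] := boolP (D1 F).
  rewrite g1P //; apply: eq_cobound => y yF.
  by rewrite (D1d _ _ _ DF1) ?subD1set.
rewrite (negPf DF1) /= in DF; rewrite g2P //.
transitivity (cobound (fun F => g2 F + cobound h F) F).
  by rewrite coboundD cobound_cobound addr0.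
apply: eq_cobound => y yF; case: ifP => // DFy.
rewrite -hP; first by ring.
  by rewrite DFy (D2d _ _ _ DF) ?subD1set.
by move: Fk; rewrite (cardsD1 y) yF => -[].
Qed.
End Acyclic.

(** * Leray numbers under deletion and contraction *)

Section Leray.
Variables (K : fieldType) (n : nat).
Implicit Types (A B F G W s t : {set 'I_n}) (D : pred {set 'I_n}).

(** [D] is [r]-Leray in the sense of Kalai and Meshulam; the strict inequality
    accounts for counting elements of a face where they use the dimension. *)
Definition leray D r := forall W k, (r < k)%N -> acyclic K (restrict D W) k.

Definition contraction_face D s : pred {set 'I_n} := fun F => D (s :|: F).

Lemma restrict_down_closed D W : down_closed D -> down_closed (restrict D W).
Proof.
move=> Dd F G GF /andP[DF FW]; apply/andP; split; first exact: Dd DF.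
exact: subset_trans FW.
Qed.

Lemma deletion_face_down_closed D s : down_closed D -> down_closed (deletion_face D s).
Proof.
move=> Dd F G GF /andP[DF FW]; apply/andP; split; first exact: Dd DF.
by apply: contraNN FW => /subset_trans; apply.
Qed.

Lemma deletion_face_restrict D s W :
  deletion_face (restrict D W) s =1 restrict (deletion_face D s) W.
Proof. by move=> F; rewrite /deletion_face /restrict andbAC. Qed.

Lemma link_restrict D s W : s \subset W ->
  link (restrict D W) s =1 restrict (contraction_face D s) (W :\: s).
Proof.
move=> sW F; rewrite /link /restrict /contraction_face subUset sW /=.
by rewrite subsetD [in RHS]disjoint_sym; case: [disjoint _ & _] (D _) => [] []; rewrite ?andbT ?andbF.
Qed.

Lemma acyclic_link_restrict D s W k :
  acyclic K (restrict (contraction_face D s) (W :\: s)) k ->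
  acyclic K (link (restrict D W) s) k.
Proof.
have [sW|sW] := boolP (s \subset W).
  by apply: eq_acyclic => F; rewrite link_restrict.
move=> _; apply: acyclic_empty => F /andP[_ /andP[_]].
by rewrite subUset (negPf sW).
Qed.

(** The complex whose only face is empty has reduced cohomology in dimension
    -1.  This is what makes every regularity nonnegative. *)
Lemma acyclic_face0 D : D set0 -> ~ acyclic K (restrict D set0) 0.
Proof.
move=> D0 /(_ (fun=> 1)) [|g /(_ set0)].
  by move=> F /andP[_]; rewrite subset0 => /eqP ->; rewrite cards0.
rewrite /restrict D0 subxx cards0 /cobound big_set0 => /(_ isT erefl)/eqP.
by rewrite oner_eq0.
Qed.

(** An induced subcomplex of the contraction on a set that meets [s] is a cone,
    and [x] is not a vertex of the contraction.  Otherwise the subcomplex is a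
    link, to which [acyclic_link_of_simplicial] applies. *)
Lemma leray_contraction D s x r : down_closed D -> D s -> x \notin s ->
  ~~ D (x |: s) ->
  exchange D s x ->
  leray D r -> exists2 r', r = (r' + #|s|)%N & leray (contraction_face D s) r'.
Proof.
move=> Dd Ds xs De Dx Lr.
have key W k : (r < k + #|s|)%N -> acyclic K (restrict (contraction_face D s) W) k.
  move=> rk; have [sW|] := boolP [disjoint s & W]; last first.
    rewrite -setI_eq0 => /set0Pn[p]; rewrite inE => /andP[ps pW].
    apply: (acyclic_cone (p := p)); last first.
      by apply: restrict_down_closed => F G GF; apply: Dd; exact: setUS.
    move=> F /andP[DF FW]; rewrite /restrict /contraction_face.
    rewrite subUset FW sub1set pW setUCA.
    have /setUidPr-> : [set p] \subset s :|: F by rewrite sub1set inE ps.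
    by rewrite !andbT.
  have xF F : D (s :|: F) -> x \notin F.
    apply: contraTN => xF; apply: contra De; apply: Dd.
    by rewrite subUset sub1set inE xF orbT subsetUl.
  have eW : [disjoint x |: s & W :\ x].
    rewrite -setI_eq0; apply/eqP/setP=> y; rewrite !inE.
    by case: eqP => [->|_] //=; case: (boolP (y \in s)) => // /(disjointFr sW).
  have := acyclic_link_of_simplicial xs eW Dd De Dx (Lr _ _ rk).
  apply: eq_acyclic => F; rewrite link_restrict ?subsetUl //.
  rewrite /restrict /contraction_face.
  have [DF|//] := boolP (D _); have {}xF := xF _ DF; rewrite /=.
  rewrite setDUl setDv set0U subsetD subsetD1 xF andbT.
  have [FW|//] := boolP (F \subset W).
  by rewrite disjoint_sym; exact: disjointWr sW.
have sr : (#|s| <= r)%N.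
  rewrite leqNgt; apply/negP => rs; apply: (@acyclic_face0 (contraction_face D s)).
    by rewrite /contraction_face setU0.
  exact: key.
exists (r - #|s|)%N; first by rewrite subnK.
by move=> W k rk; apply: key; rewrite -(subnK sr) ltn_add2r.
Qed.

(** Part (i) of the theorem on the level of complexes.  The long exact sequence
    gives both directions once [leray_contraction] has bounded the
    contraction. *)
Lemma leray_simplicial D s x r : down_closed D -> D s -> x \notin s ->
  ~~ D (x |: s) ->
  exchange D s x ->
  leray D r <-> leray (deletion_face D s) r /\
    exists2 r', r = (r' + #|s|)%N & leray (contraction_face D s) r'.
Proof.
move=> Dd Ds xs De Dx; split=> [Lr|[Lr [r' rE Lr']] W k rk].
  have [r' rE Lr'] := leray_contraction Dd Ds xs De Dx Lr.
  split; last by exists r'.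
  move=> W k rk; apply: (eq_acyclic (deletion_face_restrict D s W)).
  apply: acyclic_deletion_face; first exact: restrict_down_closed.
    exact: Lr.
  move=> k' k'k; apply: acyclic_link_restrict; apply: Lr'.
  by move: rk; rewrite -ltnS -k'k rE -addSn ltn_add2r; apply: ltnW.
apply: (acyclic_of_link (s := s)); first exact: restrict_down_closed.
  apply: (eq_acyclic (D := restrict (deletion_face D s) W)); last exact: Lr.
  by move=> F; rewrite deletion_face_restrict.
move=> k' k'k; apply: acyclic_link_restrict; apply: Lr'.
by move: rk; rewrite -k'k rE ltn_add2r.
Qed.

(** The faces that do not contain [s] are those that avoid [v] together with
    those that do not contain [s :\ v].  The two families meet in the part of
    the second one induced on the complement of [v], so the degree shift in
    Mayer-Vietoris costs one for each element of [s] after the first. *)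
Lemma leray_deletion_face D s r : down_closed D -> s != set0 ->
  (forall v, v \in s -> leray (fun F => D (F :\ v)) r) ->
  leray (deletion_face D s) (r + #|s|.-1).
Proof.
move=> Dd; have [m] := ubnP #|s|; elim: m s => // m IH s sm s0 Lr W k rk.
have [v vs] := set0Pn _ s0.
have Lv k' W' : (r < k')%N -> acyclic K (restrict (deletion_face D [set v]) W') k'.
  move=> rk'; apply: eq_acyclic (Lr v vs (W' :\ v) k' rk') => F.
  rewrite /restrict /deletion_face sub1set subsetD1.
  have [vF|vF] := boolP (v \in F); first by rewrite !andbF.
  by rewrite setD1_notin // !andbT.
have [t0|t0] := eqVneq (s :\ v) set0.
  move: rk; rewrite -(setD1K vs) t0 setU0 cards1 addn0; exact: Lv.
have ts v' : v' \in s :\ v -> v' \in s by case/setD1P.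
have sE : #|s| = #|s :\ v|.+1 by rewrite (cardsD1 v s) vs.
have tpos : (0 < #|s :\ v|)%N by rewrite card_gt0.
have Lt k' W' : (r + #|s :\ v|.-1 < k')%N ->
    acyclic K (restrict (deletion_face D (s :\ v)) W') k'.
  by apply: IH => // [|v' /ts]; [rewrite sE in sm | exact: Lr].
rewrite sE /= in rk.
have rE : (r + #|s :\ v| = (r + #|s :\ v|.-1).+1)%N by rewrite -addnS prednK.
have acU := @acyclicU K n (restrict (deletion_face D [set v]) W)
  (restrict (deletion_face D (s :\ v)) W) k.
apply: eq_acyclic (acU _ _ _ _ _).
- move=> F; rewrite /restrict /deletion_face -andb_orl -andb_orr -negb_and.
  by rewrite -subUset setD1K.
- by apply: Lv; apply: leq_ltn_trans rk; exact: leq_addr.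
- by apply: Lt; rewrite -rE ltnW.
- move=> k' k'k; apply: eq_acyclic (Lt k' (W :\ v) _).
    move=> F; rewrite /restrict /deletion_face sub1set subsetD1.
    by case: (D F) (s :\ v \subset F) (F \subset W) (v \in F) => [] [] [] [].
  by rewrite -ltnS -rE k'k.
- by apply: restrict_down_closed; exact: deletion_face_down_closed.
- by apply: restrict_down_closed; exact: deletion_face_down_closed.
Qed.
End Leray.

(** * Koszul homology of a squarefree monomial ideal, by multidegree *)

Section Hochster.
Variables (K : fieldType) (n : nat).
Local Notation R := {mpoly K[n]}.
Implicit Types (A B F G S W : {set 'I_n}) (D : pred {set 'I_n}).
Implicit Types (m u : 'X_{1..n}) (a : {set 'I_n} -> K) (C : {set 'I_n} -> R).

Definition msup m : {set 'I_n} := [set k | m k != 0%N].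
Definition heavy m : {set 'I_n} := [set k | (1 < m k)%N].
Definition ones S : 'X_{1..n} := [multinom (k \in S : nat) | k < n].

Lemma onesE S k : ones S k = (k \in S).
Proof. by rewrite mnmE. Qed.

Lemma msup_ones S : msup (ones S) = S.
Proof. by apply/setP=> k; rewrite inE onesE; case: (k \in S). Qed.

Lemma mdeg_ones S : mdeg (ones S) = #|S|.
Proof.
rewrite mdegE -sum1_card [RHS]big_mkcond /=; apply: eq_bigr => k _.
by rewrite onesE; case: (k \in S).
Qed.

Lemma onesU1 k S : k \notin S -> ones (k |: S) = (U_(k) + ones S)%MM.
Proof.
move=> kS; apply/mnmP=> l; rewrite mnmDE mnm1E !onesE !inE eq_sym.
by case: eqP => // <-; rewrite (negPf kS).
Qed.

Lemma onesD S W : S \subset W -> (ones (W :\: S) + ones S)%MM = ones W.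
Proof.
move=> /subsetP SW; apply/mnmP=> l; rewrite mnmDE !onesE !inE.
by case: (boolP (l \in S)) => //= [/SW ->|_]; rewrite ?addn0.
Qed.

Lemma ones_le S m : S \subset msup m -> (ones S <= m)%MM.
Proof.
move=> /subsetP Sm; apply/mnm_lepP => k; rewrite onesE.
by case: (boolP (k \in S)) => // /Sm; rewrite inE lt0n.
Qed.

Lemma sub_msup_addr S u : S \subset msup (u + ones S)%MM.
Proof.
by apply/subsetP=> k kS; rewrite inE mnmDE onesE kS addn1.
Qed.

Lemma msupB m S : S \subset msup m ->
  msup (m - ones S)%MM = (msup m :\: S) :|: heavy m.
Proof.
move=> /subsetP Sm; apply/setP=> k; rewrite !inE mnmBE onesE subn_eq0 -ltnNge.
case: (boolP (k \in S)) => kS //=.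
by rewrite -lt0n; case: (m k) => [|[]].
Qed.

Lemma light_ones m : heavy m = set0 -> m = ones (msup m).
Proof.
move=> /setP hm; apply/mnmP=> k; have := hm k; rewrite onesE !inE.
by case: (m k) => [|[]].
Qed.

(** [I] is the ideal of the polynomials all of whose monomials are supported on
    nonfaces of [D]. *)
Definition stanley_reisner D (I : R -> Prop) := forall f,
  I f <-> (forall u, D (msup u) -> f@_u = 0).

(** The complex that governs the Koszul complex in multidegree [m].  A Koszul
    basis set [S] corresponds to the face [msup m :\: S], and by [msupB] the
    coefficient monomial of degree [m - ones S] is supported on this face
    together with [heavy m]. *)
Definition local_face D m : pred {set 'I_n} :=
  fun F => (F \subset msup m) && D (F :|: heavy m).

Lemma local_face_ones D W : local_face D (ones W) =1 restrict D W.
Proof.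
move=> F; rewrite /local_face /restrict msup_ones andbC.
suff -> : heavy (ones W) = set0 by rewrite setU0.
by apply/setP=> k; rewrite !inE onesE; case: (_ \in _).
Qed.

(** Each variable of exponent at least two is the apex of a cone. *)
Lemma acyclic_heavy D m k : down_closed D -> heavy m != set0 ->
  acyclic K (local_face D m) k.
Proof.
move=> Dd /set0Pn[p pm]; apply: (acyclic_cone (p := p)).
  move=> F /andP[FM DF].
  have /setUidPr pE : [set p] \subset F :|: heavy m by rewrite sub1set inE pm orbT.
  rewrite /local_face subUset FM sub1set -setUA pE DF !andbT.
  by move: pm; rewrite !inE; case: (m p).
move=> F G GF /andP[FM DF]; rewrite /local_face (subset_trans GF FM) /=.
by apply: Dd DF; exact: setSU.
Qed.

(** Koszul chains become cochains by complementation in [W]; the sign turns the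
    Koszul differential into [cobound]. *)
Definition dual W a F := eps K F W * a (W :\: F).

Lemma setDDK A B : A \subset B -> B :\: (B :\: A) = A.
Proof. by move=> AB; rewrite setDDr setDv set0U; apply/setIidPr. Qed.

Lemma setDD1 k F W : k \in F -> F \subset W -> W :\: (F :\ k) = k |: (W :\: F).
Proof.
move=> kF /subsetP FW; rewrite setDDr setUC; congr (_ :|: _).
by apply/setIidPr; rewrite sub1set FW.
Qed.

(** The Koszul differential on the coefficients in a multidegree with support
    [W]. *)
Definition diff_at W a S : K := \sum_(k in W :\: S) eps K [set k] S * a (k |: S).

Lemma cobound_dual W a F : F \subset W ->
  cobound (dual W a) F = eps K F W * diff_at W a (W :\: F).
Proof.
move=> FW; rewrite /cobound /diff_at mulr_sumr setDDK //.
apply: eq_bigr => k kF; rewrite /dual setDD1 // (epsD1l K _ kF).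
have -> : eps K [set k] W = eps K [set k] F * eps K [set k] (W :\: F).
  by rewrite -epsUr ?disjoint_setD // setUDK.
rewrite -[LHS]mul1r -(eps_sq K [set k] (W :\: F)); ring.
Qed.

Lemma dual_inv W a F : F \subset W ->
  dual W (fun S => eps K (W :\: S) W * a (W :\: S)) F = a F.
Proof. by move=> FW; rewrite /dual setDDK // mulrA eps_sq mul1r. Qed.

Lemma local_exact D m i a :
  ((i <= #|msup m|)%N -> acyclic K (local_face D m) (#|msup m| - i)) ->
  (forall S, S \subset msup m -> #|S|.+1 = i -> D (msup (m - ones S)%MM) ->
     diff_at (msup m) a S = 0) ->
  exists b, forall S, S \subset msup m -> #|S| = i -> D (msup (m - ones S)%MM) ->
     a S = diff_at (msup m) b S.
Proof.
move=> ac az; set M := msup m in ac az *.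
have [iM|iM] := leqP i #|M|; last first.
  exists a => S /subset_leq_card + Si _.
  by rewrite Si leqNgt iM.
have face S : S \subset M -> D (msup (m - ones S)%MM) = local_face D m (M :\: S).
  by move=> SM; rewrite msupB // /local_face subsetDl.
have [|g gP] := ac iM (dual M a).
  move=> F lF Fk; have FM : F \subset M by case/andP: lF.
  rewrite cobound_dual // az ?mulr0 ?subsetDl //.
    by by have := subset_leq_card FM; rewrite cardsD (setIidPr FM) Fk; lia.
  by rewrite face ?subsetDl // setDDK.
exists (fun S => eps K (M :\: S) M * g (M :\: S)) => S SM Si DS.
have FM := subsetDl M S; have FK := setDDK SM.
have := gP (M :\: S); rewrite -face // cardsD (setIidPr SM) Si => /(_ DS erefl).
rewrite (eq_cobound (g := dual M (fun S => eps K (M :\: S) M * g (M :\: S)))); last first.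
  by move=> k kF; rewrite dual_inv // (subset_trans (subD1set _ _) FM).
rewrite cobound_dual // /dual FK => /(congr1 (fun z => eps K (M :\: S) M * z)).
by rewrite !mulrA eps_sq !mul1r.
Qed.

Lemma coef_koszul_d C m S : S \subset msup m ->
  (koszul_d C S)@_(m - ones S)%MM =
  diff_at (msup m) (fun S => (C S)@_(m - ones S)%MM) S.
Proof.
move=> Sm; rewrite koszul_coef_d; apply: eq_big => [k|k /andP[kS mk]].
  rewrite !inE mnmBE onesE; case: (boolP (k \in S)) => //= _.
  by rewrite subn0.
rewrite eps1E; congr (_ * _); congr (_ @_ _).
apply/mnmP=> l; rewrite onesU1 // !mnmBE mnmDE; lia.
Qed.


Local Notation Q := (koszul_resolution K n).

Lemma eq_koszul_d i (c : koszul_basis n i.+1 -> R) C (b : koszul_basis n i) :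
  (forall b', c b' = C (val b')) ->
  matrix_map (@koszul_diff K n i) c b = koszul_d C (val b).
Proof.
move=> cC; rewrite koszul_dE; apply: koszul_d_eq => k kb.
have Ub : #|k |: val b| == i.+1 by rewrite cardsU1 kb (eqP (valP b)).
by rewrite -[k |: val b]/(val (Sub (k |: val b) Ub : koszul_basis n i.+1)) koszul_extE cC.
Qed.

(** A cycle is bounded in each multidegree of degree [j] separately: by
    hypothesis in the squarefree ones and by [acyclic_heavy] in the others.  The
    bounding chains are then assembled into polynomials. *)
Lemma not_Tor_of_acyclic D I i j : stanley_reisner D I -> down_closed D ->
  ((i <= j)%N -> forall W, #|W| = j -> acyclic K (restrict D W) (j - i)) ->
  ~ Tor_neq0 Q I i j.
Proof.
move=> SR Dd ac [c [ch cc]]; apply.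
pose C := koszul_ext c.
pose ok m b := forall S, S \subset msup m -> #|S| = i ->
  D (msup (m - ones S)%MM) -> (C S)@_(m - ones S) = diff_at (msup m) b S.
have ex m : mdeg m = j -> exists b, ok m b.
  move=> mj; apply: local_exact => [iM|S SM Si DS].
    have [h0|h0] := eqVneq (heavy m) set0; last exact: acyclic_heavy.
    have mE := light_ones h0.
    have Mj : #|msup m| = j by rewrite -mj {2}mE mdeg_ones.
    rewrite Mj {1}mE; apply: eq_acyclic (ac _ _ Mj); last by rewrite -Mj.
    by move=> F; rewrite local_face_ones.
  rewrite -coef_koszul_d //.
  case: i Si c ch cc @C @ok {ac} => // i [Si] c ch cc /=.
  have Sb : #|S| == i by rewrite Si.
  have := cc (Sub S Sb : koszul_basis n i).
  rewrite [matrix_map _ _ _]koszul_dE /= => /SR; exact.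
(* [gam m] holds the coefficients in multidegree [m] of the bounding chain. *)
pose gam m := epsilon (inhabits (fun=> 0)) (ok m).
have gamP m : mdeg m = j -> ok m (gam m) by move=> /ex; exact: epsilon_spec.
pose C' S : R := \sum_(u : 'X_{1..n < j.+1} | (mdeg u + #|S|)%N == j)
  gam (u + ones S)%MM S *: 'X_[u].
have coefC' S u : (C' S)@_u = if (mdeg u + #|S|)%N == j then gam (u + ones S)%MM S else 0.
  rewrite /C' raddf_sum /=; case: ifPn => uj; last first.
    apply: big1 => v vj; rewrite mcoeffZ mcoeffX.
    case: eqP => [vu|_]; last by rewrite mulr0.
    by rewrite -vu vj in uj.
  have uj' : (mdeg u < j.+1)%N by rewrite ltnS -(eqP uj) leq_addr.
  rewrite (bigD1 (BMultinom uj')) //= big1 ?addr0.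
    by rewrite mcoeffZ mcoeffX eqxx mulr1.
  move=> v /andP[_ vu]; rewrite mcoeffZ mcoeffX.
  by rewrite -[u]/(bmnm (BMultinom uj')) (inj_eq val_inj) (negPf vu) mulr0.
exists (fun b : koszul_basis n i.+1 => C' (val b)) => [b|b].
  rewrite /shifted_homog /=; have Sb := eqP (valP b : #|val b| == i.+1).
  have [ij|ij] := ltnP i j.
    rewrite /C'; apply: rpred_sum => u uj; apply: rpredZ; rewrite dhomogX /=.
    by rewrite -(inj_eq (@addIn i.+1)) subnK // -{1}Sb.
  rewrite /C' big_pred0 // => u; apply/negP => /eqP uj.
  by move: ij; rewrite leqNgt -uj Sb leq_addl.
apply/SR => u Du; rewrite mcoeffB.
rewrite [matrix_map _ _ _](@eq_koszul_d _ _ C') //.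
have Sb := eqP (valP b : #|val b| == i); set S := val b in Sb *.
have cE : c b = C S by rewrite /C koszul_extE.
have uE : u = ((u + ones S) - ones S)%MM by rewrite addmK.
have SM := sub_msup_addr S u.
have [uj|uj] := eqVneq (mdeg u + #|S|)%N j.
  have mj : mdeg (u + ones S)%MM = j by rewrite mdegD mdeg_ones.
  apply/eqP; rewrite subr_eq0; apply/eqP.
  rewrite cE [in LHS]uE [in RHS]uE gamP //; last by rewrite -uE.
  rewrite coef_koszul_d //; apply: eq_bigr => k; rewrite inE => /andP[kS kM].
  congr (_ * _); have kSM : k |: S \subset msup (u + ones S)%MM.
    by rewrite subUset sub1set kM SM.
  have kj : (mdeg ((u + ones S) - ones (k |: S))%MM + #|k |: S|)%N = j.
    by rewrite -mj -[in RHS](submK (ones_le kSM)) mdegD mdeg_ones.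
  by rewrite coefC' kj eqxx submK ?ones_le.
rewrite koszul_coef_d big1 ?subr0; last first.
  move=> k /andP[kS uk]; rewrite coefC' ifN ?mulr0 //.
  have ku : (U_(k) <= u)%MM by rewrite lep1mP.
  by rewrite cardsU1 kS addnA -[in mdeg u](submK ku) mdegD mdeg1 in uj *.
have := ch b; rewrite /shifted_homog /=; have [ij|ij] := leqP i j; last first.
  by move/eqP->; rewrite mcoeff0.
move=> /dhomog_nemf_coeff; apply.
by apply: contraNneq uj => ->; rewrite Sb subnK.
Qed.

(** Conversely, a cochain on [restrict D W] gives a Koszul chain of multidegree
    [ones W], and the coefficients in this multidegree of a bounding chain would
    cobound it. *)
Lemma Tor_of_not_acyclic D I W k : stanley_reisner D I ->
  ~ acyclic K (restrict D W) k -> (k <= #|W|)%N /\ Tor_neq0 Q I (#|W| - k) #|W|.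
Proof.
move=> SR nac.
have kW : (k <= #|W|)%N.
  rewrite leqNgt; apply/negP => Wk; apply: nac; apply: acyclic_empty => F.
  by move=> /andP[_ /subset_leq_card FW]; rewrite neq_ltn (leq_ltn_trans FW Wk).
split=> //; apply: NNPP => nT; apply: nac => f fz.
pose C S : R := if S \subset W then
  (eps K (W :\: S) W * f (W :\: S)) *: 'X_[ones (W :\: S)] else 0.
have Wik : (#|W| - (#|W| - k))%N = k by rewrite subKn.
move: (#|W| - k)%N nT Wik (leq_subr k #|W|) => i nT Wik iW.
have coefC S u : (C S)@_u = if (S \subset W) && (ones (W :\: S) == u) then
    eps K (W :\: S) W * f (W :\: S) else 0.
  rewrite /C; case: ifP => _ /=; last by rewrite mcoeff0.
  by rewrite mcoeffZ mcoeffX; case: ifP; rewrite ?mulr1 ?mulr0.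
have onesB S : S \subset W -> (ones W - ones S)%MM = ones (W :\: S).
  by move=> SW; rewrite -(onesD SW) addmK.
have cyc i' S u : i = i'.+1 -> #|S| = i' -> D (msup u) -> (koszul_d C S)@_u = 0.
  move=> ii' Si Du; have [uW|uW] := eqVneq (u + ones S)%MM (ones W).
    have SW : S \subset W by rewrite -(msup_ones W) -uW sub_msup_addr.
    have uE : u = ones (W :\: S) by rewrite -onesB // -uW addmK.
    rewrite uE -onesB // coef_koszul_d ?msup_ones //.
    have FW := subsetDl W S.
    have DF : restrict D W (W :\: S).
      by rewrite /restrict FW andbT -(msup_ones (W :\: S)) -uE.
    have := fz _ DF; rewrite cardsD (setIidPr SW) Si.
    have -> : (#|W| - i')%N = k.+1 by have := subset_leq_card SW; lia.
    move=> /(_ erefl).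
    rewrite (eq_cobound (g := dual W (fun S => eps K (W :\: S) W * f (W :\: S)))).
      rewrite cobound_dual // setDDK // => /eqP.
      rewrite mulf_eq0 => /orP[/eqP e0|/eqP <-].
        by have := eps_sq K (W :\: S) W; rewrite e0 mul0r => /eqP; rewrite eq_sym oner_eq0.
      apply: eq_bigr => k' ; rewrite inE => /andP[k'S k'W].
      have kSW : k' |: S \subset W by rewrite subUset sub1set k'W.
      by rewrite coefC kSW onesB // eqxx.
    by move=> k' k'F; rewrite dual_inv // (subset_trans (subD1set _ _) FW).
  rewrite koszul_coef_d big1 // => k' /andP[k'S uk'].
  rewrite coefC; case: andP => [[kSW /eqP uE]|_]; last by rewrite mulr0.
  case/eqP: uW; rewrite -(onesD kSW) uE onesU1 // addmA submK ?lep1mP //.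
have [c' c'h c'P] : is_boundary (Q := Q) I #|W| (fun b : koszul_basis n i => C (val b)).
  apply: NNPP => nb; apply: nT; exists (fun b : koszul_basis n i => C (val b)).
  split=> //.
    move=> b; have Sb := eqP (valP b : #|val b| == i).
    rewrite /shifted_homog /= iW Wik /C.
    case: ifP => [SW|_]; last exact: rpred0.
    rewrite rpredZ // dhomogX /= mdeg_ones cardsD (setIidPr SW).
    by rewrite Sb Wik.
  clear nb; case: i Wik iW cyc => // i' Wik iW cyc b.
  apply/SR => u Du; rewrite [matrix_map _ _ _](@eq_koszul_d _ _ C) //.
  by apply: cyc Du => //; exact: eqP (valP b : #|val b| == i').
exists (dual W (fun S => (koszul_ext c' S)@_(ones W - ones S))) => F /andP[DF FW] Fk.
have Sb : #|W :\: F| == i by rewrite cardsD (setIidPr FW) Fk -Wik subKn.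
pose b : koszul_basis n i := Sub (W :\: F) Sb.
have /SR/(_ (ones F)) := c'P b.
rewrite msup_ones => /(_ DF).
rewrite [matrix_map _ _ _]koszul_dE mcoeffB coefC.
rewrite [val b]/(W :\: F) subsetDl setDDK // eqxx /= => /eqP.
rewrite subr_eq0 => /eqP E.
rewrite cobound_dual //.
have oF : ones F = (ones W - ones (W :\: F))%MM by rewrite onesB ?subsetDl // setDDK.
rewrite oF coef_koszul_d ?msup_ones ?subsetDl // in E.
rewrite -E mulrA eps_sq mul1r; by [].
Qed.
End Hochster.

(** * Regularity and Leray numbers; edge ideals and clutter minors *)

Section Regularity.
Variables (K : fieldType) (n : nat).
Local Notation R := {mpoly K[n]}.
Implicit Types (D : pred {set 'I_n}) (I J : R -> Prop) (S : {set 'I_n}).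

Lemma leray_dim D : leray K D n.
Proof.
move=> W k nk; apply: acyclic_empty => F _.
by rewrite neq_ltn (leq_ltn_trans _ nk) // -[X in (_ <= X)%N]card_ord max_card.
Qed.

(** The class of largest degree found by Hochster's formula attains the maximum
    that defines the regularity.  As [D set0] holds, there is at least the class
    of the empty set, so the regularity is a natural number. *)
Lemma reg_quot_leray D I : stanley_reisner D I -> down_closed D -> D set0 ->
  exists2 r : nat, reg_quot I = r%:Z &
    forall q, leray K D q <-> (r <= q)%N.
Proof.
move=> SR Dd D0.
pose P q : bool := if excluded_middle_informative (leray K D q) then true else false.
have PP q : reflect (leray K D q) (P q).
  by rewrite /P; case: excluded_middle_informative => h; constructor.
have exP : exists q, P q by exists n; apply/PP; exact: leray_dim.
case: (ex_minnP exP) => r /PP Lr rmin.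
have LP q : leray K D q <-> (r <= q)%N.
  split=> [/PP /rmin //|rq W k qk]; apply: Lr; exact: leq_ltn_trans qk.
have nz : exists W, ~ acyclic K (restrict D W) r.
  have [r0|r0] := posnP r; first by exists set0; rewrite r0; exact: acyclic_face0.
  apply: NNPP => nW; have : leray K D r.-1.
    move=> W k rk; apply: NNPP => na.
    have [kr|rk'] := leqP k r; last exact: na (Lr _ _ rk').
    apply: nW; exists W; suff -> : r = k by [].
    by apply/eqP; rewrite eqn_leq kr andbT -(prednK r0).
  by move/LP; rewrite -ltnS prednK // ltnn.
exists r => //; have ex : is_reg_quot I r%:Z.
  split.
    have [W nW] := nz; have [rW T] := Tor_of_not_acyclic SR nW.
    exists (#|W| - r)%N, #|W|; split=> //; lia.
  move=> i j Tij; have [ij [W Wj na]] : (i <= j)%N /\ exists2 W : {set 'I_n}, #|W| = j & ~ acyclic K (restrict D W) (j - i).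
    have nA := not_Tor_of_acyclic SR Dd (i := i) (j := j).
    split; first by rewrite leqNgt; apply/negP => ji; apply: nA => //; rewrite leqNgt ji.
    apply: NNPP => nW; apply: nA => // ij W Wj; apply: NNPP => na.
    by apply: nW; exists W.
  suff jir : (j - i <= r)%N by rewrite subzn // lez_nat.
  by rewrite leqNgt; apply/negP => rji; apply: na; exact: Lr.
have [[i [j [Tij ->]]] ub] : is_reg_quot I (reg_quot I).
  by apply: epsilon_spec; exists r%:Z.
have [[i' [j' [Tij' E]]] ub'] := ex.
by apply/eqP; rewrite eq_le ub' //= E; have := ub _ _ Tij'; rewrite /reg_quot.
Qed.

Lemma eq_stanley_reisner D D' I : D =1 D' -> stanley_reisner D I -> stanley_reisner D' I.
Proof.
by move=> E SR f; split=> [/SR h u|h]; [rewrite -E; exact: h | apply/SR => u; rewrite E; exact: h].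
Qed.

Lemma mcoeffMX_eq0 (p : R) m u : ~~ (m <= u)%MM -> (p * 'X_[m])@_u = 0.
Proof.
move=> mu; apply: memN_msupp_eq0; rewrite (perm_mem (msuppMX p m)).
by apply/mapP => -[v _ E]; move: mu; rewrite E lem_addr.
Qed.

Lemma ideal_gen_monomials (ms : seq 'X_{1..n}) (f : R) :
  ideal_gen [seq 'X_[m] | m <- ms] f <->
  (forall u, f@_u != 0 -> has (fun m => (m <= u)%MM) ms).
Proof.
split=> [[c ->] u|fms].
  apply: contraNT => /hasPn nm; rewrite raddf_sum /= big1 // => i _.
  have im : (i < size ms)%N by rewrite -(size_map (fun m => 'X_[m] : R) ms).
  rewrite (nth_map 0%MM) // mcoeffMX_eq0 //; exact: nm (mem_nth _ im).
(* Each monomial of [f] is charged to the first generator that divides it. *)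
pose idx u := find (fun m => (m <= u)%MM) ms.
pose N := size [seq 'X_[m] : R | m <- ms].
exists (fun i : 'I_N => \sum_(u <- msupp f | idx u == i) f@_u *: 'X_[u - nth 0%MM ms i]).
transitivity (\sum_(i < N) \sum_(u <- msupp f | idx u == i) f@_u *: 'X_[u] : R); last first.
  apply: eq_bigr => i _; rewrite mulr_suml big_seq_cond [RHS]big_seq_cond.
  apply: eq_bigr => u /andP[uf /eqP ui].
  have im : (i < size ms)%N by rewrite -(size_map (fun m => 'X_[m] : R) ms).
  rewrite (nth_map 0%MM) // -scalerAl -mpolyXD submK //.
  rewrite -ui; apply: (@nth_find _ 0%MM (fun m => (m <= u)%MM)); apply: fms.
  by rewrite -mcoeff_msupp.
rewrite [LHS]mpolyE.
rewrite (exchange_big_dep xpredT) //= big_seq [RHS]big_seq; apply: eq_bigr => u uf.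
have iN : (idx u < N)%N.
  by rewrite /N size_map -has_find; apply: fms; rewrite -mcoeff_msupp.
by rewrite (bigD1 (Ordinal iN)) //= big1 ?addr0 // => i /andP[/eqP E]; rewrite -val_eqE /= E eqxx.
Qed.

Lemma ones_leE S u : (ones S <= u)%MM = (S \subset msup u).
Proof.
apply/idP/idP => [/mnm_lepP le|/ones_le //].
apply/subsetP => k kS; have := le k; rewrite onesE kS inE.
by case: (u k).
Qed.

Lemma mpolyX_ones S : 'X_[ones S] = \prod_(k in S) 'X_k :> R.
Proof.
rewrite mpolyXE_id [RHS]big_mkcond /=; apply: eq_bigr => k _.
by rewrite onesE; case: (k \in S); rewrite ?expr1 ?expr0.
Qed.

Lemma stanley_reisner_gen (Es : seq {set 'I_n}) :
  stanley_reisner (fun F => all (fun S => ~~ (S \subset F)) Es)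
    (ideal_gen [seq 'X_[ones A] : R | A <- Es]).
Proof.
move=> f.
have -> : [seq 'X_[ones A] : R | A <- Es] = [seq 'X_[m] : R | m <- map (@ones n) Es].
  by rewrite -map_comp.
have E u : has (fun m => (m <= u)%MM) (map (@ones n) Es) = ~~ all (fun S => ~~ (S \subset msup u)) Es.
  rewrite -has_predC has_map; apply: eq_has => S /=; by rewrite negbK ones_leE.
split=> [/ideal_gen_monomials h u aE|h].
  by apply: contraTeq aE => /h; rewrite E.
by apply/ideal_gen_monomials => u; apply: contraNT; rewrite E negbK => /h ->.
Qed.

Lemma stanley_reisner_add D D' I J : stanley_reisner D I -> stanley_reisner D' J ->
  stanley_reisner (fun F => D F && D' F) (ideal_add I J).
Proof.
move=> SI SJ f; split=> [[g [h [/SI Ig /SJ Jh ->]]] u /andP[Du D'u]|fD].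
  by rewrite mcoeffD Ig // Jh // addr0.
pose g : R := \sum_(u <- msupp f | ~~ D (msup u)) f@_u *: 'X_[u].
have gE u : g@_u = if D (msup u) then 0 else f@_u.
  rewrite /g raddf_sum /=; case: ifPn => Du.
    rewrite big1 // => v Dv; rewrite mcoeffZ mcoeffX.
    by case: eqP => [E|_]; [rewrite -E (negPf Dv) in Du | rewrite mulr0].
  rewrite [in RHS](mpolyE f) raddf_sum /= big_mkcond; apply: eq_bigr => v _.
  rewrite mcoeffZ mcoeffX; case: eqP => [->|_]; first by rewrite Du.
  by rewrite mulr0 if_same.
exists g, (f - g); split; last by rewrite addrC subrK.
  by apply/SI => u Du; rewrite gE Du.
apply/SJ => u D'u; rewrite mcoeffB gE.
by case: ifP => Du; rewrite ?subrr // subr0 fD // Du.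
Qed.
End Regularity.

Section Clutter.
Variables (K : fieldType) (T : finType).
Implicit Types (H G : set_system T) (v : T) (A F : {set 'I_#|T|}) (e : {set T}).

Definition ranks e : {set 'I_#|T|} := [set enum_rank y | y in e].

Definition face H : pred {set 'I_#|T|} :=
  fun F => [forall e in edges H, ~~ (ranks e \subset F)].

Lemma mem_ranks v e : (enum_rank v \in ranks e) = (v \in e).
Proof. by rewrite mem_imset //; exact: enum_rank_inj. Qed.

Lemma ranks_sub e e' : (ranks e \subset ranks e') = (e \subset e').
Proof.
apply/subsetP/subsetP => h y; first by move=> ye; rewrite -mem_ranks h // mem_ranks.
by case/imsetP => z ze ->; rewrite mem_ranks h.
Qed.

Lemma ranksD1 e v : ranks (e :\ v) = ranks e :\ enum_rank v.
Proof.
apply/setP => k; rewrite -(enum_valK k) mem_ranks !inE mem_ranks.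
by rewrite (inj_eq enum_rank_inj).
Qed.

Lemma card_ranks e : #|ranks e| = #|e|.
Proof. by apply: card_imset; exact: enum_rank_inj. Qed.

Lemma edge_monomialE e : edge_monomial K e = 'X_[ones (ranks e)].
Proof.
rewrite mpolyX_ones /ranks big_imset //=; by move=> y z _ _ /enum_rank_inj.
Qed.

Lemma face_down_closed H : down_closed (face H).
Proof.
move=> F G GF /forall_inP DF; apply/forall_inP => e eH.
by apply: contra (DF e eH) => /subset_trans; apply.
Qed.

Lemma stanley_reisner_edge_ideal H : stanley_reisner (face H) (edge_ideal K H).
Proof.
have := @stanley_reisner_gen K _ [seq ranks e | e <- enum (edges H)].
rewrite -map_comp /edge_ideal (eq_map (g := @edge_monomial K T)); last first.
  by move=> e; rewrite edge_monomialE.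
apply: eq_stanley_reisner => F; rewrite all_map.
apply/allP/forall_inP => h e eH; apply: h; by rewrite mem_enum in eH *.
Qed.

(** Passing to inclusion-minimal sets does not change which sets contain an
    edge. *)
Lemma face_contraction H v F : face (contraction H v) F = face H (enum_rank v |: F).
Proof.
apply/forall_inP/forall_inP => h e eH; last first.
  move: eH; rewrite inE => /minsetP[/imsetP[e' e'H ->] _].
  by apply: contra (h e' e'H); rewrite ranksD1 subDset.
have [|f fmin fe] := @minset_exists _ (fun g => g \in [set e0 :\ v | e0 in edges H]) (e :\ v).
  exact: imset_f.
apply: contra (h f _); last by rewrite inE.
move=> eF; apply: (@subset_trans _ _ (mem (ranks (e :\ v)))); first by rewrite ranks_sub.
by rewrite ranksD1 subDset.
Qed.

Lemma face_contraction_seq H (vs : seq T) :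
  face (contraction_seq H vs) =1 contraction_face (face H) (ranks [set y in vs]).
Proof.
rewrite /contraction_face; elim: vs H => [|v vs IH] H F.
  by rewrite (_ : ranks _ = set0) ?set0U //; apply/setP=> k; rewrite -(enum_valK k) mem_ranks !inE.
rewrite [LHS]IH face_contraction setUA; congr (face H (_ :|: _)).
apply/setP=> k; rewrite -(enum_valK k) !inE !mem_ranks !inE.
by rewrite (inj_eq enum_rank_inj).
Qed.

Lemma face_deletion H v F : face (deletion H v) F = face H (F :\ enum_rank v).
Proof.
apply/forall_inP/forall_inP => h e eH.
  rewrite subsetD1 mem_ranks; have [ve|ve] := boolP (v \in e); first by rewrite andbF.
  by rewrite andbT; apply: h; rewrite inE eH.
move: eH; rewrite inE => /andP[/h]; rewrite subsetD1 mem_ranks => nF ve.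
by move: nF; rewrite ve andbT.
Qed.

(** An edge inside [((x |: s) :\ k) :|: F] differs from [e] at [k] and must
    contain [x]; simpliciality then yields an edge inside [s :|: F]. *)
Lemma simplicial_exchange H x e (s : {set 'I_#|T|}) :
  simplicial H x -> e \in edges H -> ranks e = enum_rank x |: s ->
  enum_rank x \notin s ->
  exchange (face H) s (enum_rank x).
Proof.
move=> [_ Hsimp] Hedge eE xs F k sF DsF ks.
have xe : x \in e by rewrite -mem_ranks eE !inE eqxx.
apply/forall_inP => f fH; apply/negP => fsub.
have kf : k \notin ranks f.
  apply/negP => /(subsetP fsub); rewrite !inE eqxx /=.
  by rewrite (disjointFr sF ks).
have [xf|xf] := boolP (x \in f); last first.
  have : ~~ (ranks f \subset s :|: F) by exact: (forall_inP DsF).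
  case/negP; apply/subsetP => l lf; have := subsetP fsub l lf.
  rewrite !inE; case/orP => [/andP[_ /orP[/eqP lX|->//]]|->]; last by rewrite orbT.
  by move: lf; rewrite lX mem_ranks (negPf xf).
have ef : e <> f by move=> E; move: kf; rewrite -E eE inE ks orbT.
have [g gH gsub] := Hsimp e f Hedge fH ef xe xf.
have : ~~ (ranks g \subset s :|: F) by exact: (forall_inP DsF).
case/negP; apply/subsetP => l; rewrite -(enum_valK l) mem_ranks => /(subsetP gsub).
rewrite in_setD1 in_setU => /andP[lx le].
have {}lx : enum_rank (enum_val l) != enum_rank x by rewrite (inj_eq enum_rank_inj).
case/orP: le; rewrite -mem_ranks.
  by rewrite eE !inE (negPf lx) /= => ->.
by move=> /(subsetP fsub); rewrite !inE (negPf lx) /= => /orP[/andP[_ ->]|->]; rewrite ?orbT.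
Qed.
End Clutter.

Theorem theorem2p12 (K : fieldType) (T : finType) (H : set_system T)
    (d : nat) (x : T) (xs : d.-tuple T)
    (HV : vertices H = [set: T])
    (Hchordal : chordal H)
    (Hsimplicial : simplicial H x)
    (Huniq : uniq (x :: xs))
    (Hedge : [set y in x :: xs] \in edges H) :
  reg_quot (edge_ideal K H) =
    Num.max
      (reg_quot (ideal_add
                   (ideal_gen [:: \prod_(i < d) vvar K (tnth xs i)])
                   (edge_ideal K H)))
      (reg_quot (edge_ideal K (contraction_seq H xs)) + d%:Z)
  /\
  reg_quot (edge_ideal K H) <=
    Num.max
      (\sum_(i < d) reg_quot (edge_ideal K (deletion H (tnth xs i)))
         + (d%:Z - 1))
      (reg_quot (edge_ideal K (contraction_seq H xs)) + d%:Z).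
Proof.
case: Hchordal => -[_ Hanti Hcard] _.
have /andP[xxs xsU] := Huniq.
set e := [set y in x :: xs] in Hedge.
pose s := ranks [set y in xs]; pose D := face H; pose X := enum_rank x.
have Dd : down_closed D by exact: face_down_closed.
have eE : ranks e = X |: s.
  apply/setP=> k; rewrite -(enum_valK k) !inE !mem_ranks !inE.
  by rewrite (inj_eq enum_rank_inj).
have Xs : X \notin s by rewrite mem_ranks inE.
have sd : #|s| = d by rewrite card_ranks cardsE (card_uniqP xsU) size_tuple.
have dpos : (0 < d)%N.
  by have := Hcard e Hedge; rewrite -card_ranks eE cardsU1 Xs sd.
have s0 : s != set0 by rewrite -card_gt0 sd.
have De : ~~ D (X |: s).
  by apply/forall_inPn; exists e; rewrite // negbK eE.
(* An edge inside [s] would be properly contained in the edge [e]. *)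
have Ds : D s.
  apply/forall_inP => f fH; apply/negP; rewrite ranks_sub => fs.
  have fe : f \subset e by apply: subset_trans fs _; apply/subsetP => y; rewrite !inE orbC => ->.
  have xf : x \in f by rewrite (Hanti _ _ fH Hedge fe) !inE eqxx.
  by move: (subsetP fs _ xf); rewrite inE (negPf xxs).
have D0 : D set0 by apply: Dd Ds; exact: sub0set.
have Dx := simplicial_exchange Hsimplicial Hedge eE Xs.
have SRH := @stanley_reisner_edge_ideal K T H.
have [r rE rP] := reg_quot_leray SRH Dd D0.
have SRdel : stanley_reisner (deletion_face D s) (ideal_add
    (ideal_gen [:: \prod_(i < d) vvar K (tnth xs i)]) (edge_ideal K H)).
  have Sf := @stanley_reisner_gen K _ [:: s].
  have -> : \prod_(i < d) vvar K (tnth xs i) = 'X_[ones s].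
    rewrite -[RHS]edge_monomialE /edge_monomial.
    rewrite -(big_tuple _ _ xs xpredT (@vvar K T)) big_uniq //=.
    by apply: eq_bigl => y; rewrite inE.
  apply: eq_stanley_reisner (stanley_reisner_add Sf SRH).
  by move=> F /=; rewrite andbT andbC.
have delD0 : deletion_face D s set0 by rewrite /deletion_face D0 subset0.
have [r1 r1E r1P] := reg_quot_leray SRdel (@deletion_face_down_closed _ D s Dd) delD0.
have SRc := @stanley_reisner_edge_ideal K T (contraction_seq H xs).
have cD0 : face (contraction_seq H xs) set0.
  by rewrite face_contraction_seq /contraction_face setU0.
have [r2 r2E r2P] := reg_quot_leray SRc (@face_down_closed _ _) cD0.
have Lc q : leray K (contraction_face D s) q <-> (r2 <= q)%N.
  rewrite -r2P; split=> L W k qk; apply: eq_acyclic (L W k qk) => F;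
  by rewrite /restrict face_contraction_seq.
have rmax : r = maxn r1 (r2 + d).
  have key q : (r <= q)%N <-> (r1 <= q)%N /\ (r2 + d <= q)%N.
    rewrite -rP -r1P (@leray_simplicial K _ D s X q Dd Ds Xs De Dx) sd.
    split=> -[h1 h2]; split=> //.
      by case: h2 => r' -> /Lc; rewrite leq_add2r.
    exists (q - d)%N; first by rewrite subnK // (leq_trans _ h2) // leq_addl.
    by apply/Lc; rewrite leq_subRL ?(leq_trans _ h2) ?leq_addl // addnC.
  apply/eqP; rewrite eqn_leq; apply/andP; split.
    by apply/key; rewrite leq_maxl leq_maxr.
  by rewrite geq_max; apply/andP; apply/key.
have deldel (i : 'I_d) : exists2 q : nat, reg_quot (edge_ideal K (deletion H (tnth xs i))) = q%:Z &
    leray K (fun F => D (F :\ enum_rank (tnth xs i))) q.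
  have [|q qE qP] := reg_quot_leray (@stanley_reisner_edge_ideal K T (deletion H (tnth xs i))) (@face_down_closed _ _).
    by rewrite face_deletion; apply: Dd D0; exact: subD1set.
  exists q => // W k qk; have /qP/(_ W k qk) := leqnn q.
  by apply: eq_acyclic => F; rewrite /restrict face_deletion.
pose q (i : 'I_d) : nat := `|reg_quot (edge_ideal K (deletion H (tnth xs i)))|%N.
have qE i : reg_quot (edge_ideal K (deletion H (tnth xs i))) = (q i)%:Z.
  by rewrite /q; have [q0 -> _] := deldel i; rewrite absz_nat.
have qP i : leray K (fun F => D (F :\ enum_rank (tnth xs i))) (q i).
  by rewrite /q; have [q0 -> Lq0] := deldel i; rewrite absz_nat.
(* The maximum bound of [leray_deletion_face] is weakened to the sum. *)
have r1le : (r1 <= \sum_i q i + d.-1)%N.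
  apply/r1P; rewrite -[X in (_ + X.-1)%N]sd; apply: leray_deletion_face => // v.
  rewrite -(enum_valK v) mem_ranks inE => /tnthP[i iE] W k qk.
  rewrite iE; apply: (qP i); apply: leq_ltn_trans qk.
  by rewrite (bigD1 i) //= leq_addr.
have rI : (r : int) = Num.max r1%:Z (r2%:Z + d%:Z) by rewrite rmax; lia.
rewrite rE r1E r2E; split=> //.
rewrite rI (eq_bigr _ (fun i _ => qE i)) -(big_morph Posz PoszD (erefl _)).
move: (\sum_i q i)%N r1le => N r1le; clear -dpos r1le.
by lia.
Qed.
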